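(* Let $\Lambda\subset(0,\infty)$ be finite or countable. Each irreducible unitary representation of $\mathbb I_\Lambda$ is (equivalent to) a subrepresentation of a quasiregular representation of $\mathbb I_\Lambda$ in $\ell^2$ on some homogeneous space $\mathbb I\{\mathrm B_j\}\backslash\mathbb I_\Lambda$, where $\{\mathrm B_j\}$ is a finite collection of pairwise disjoint balls in $\mathbb U_\Lambda$ of $\Lambda$-perfect types and $\mathbb I\{\mathrm B_j\}$ is the subgroup of all isometries sending each ball $\mathrm B_j$ to itself.
   Context: An ultrametric space is a metric space with $d(x,z)\le\max(d(x,y),d(y,z))$; its spectrum is its set of nonzero distances. $\mathbb U_\Lambda$ is the ultrametric Urysohn space: the unique (up to isometry) complete separable ultrametric space with spectrum $\Lambda$ such that for any finite ultrametric spaces $X\subset Y$ with spectra in $\Lambda$, each isometric embedding $X\to\mathbb U_\Lambda$ extends to an isometric embedding $Y\to\mathbb U_\Lambda$. $\mathbb I_\Lambda$ is the group of all bijective isometries of $\mathbb U_\Lambda$ with the topology of pointwise convergence (a Polish group). Unitary representations are continuous homomorphisms to the unitary group (strong operator topology) of a separable Hilbert space. Balls: $\mathrm B^c(a,r)=\{x:d(a,x)\le r\}$, $\mathrm B^o(a,r)=\{x:d(a,x)<r\}$. Let $\Lambda^{+0}=\Lambda$ if $0$ is a limit point of $\Lambda$ and $\Lambda^{+0}=\Lambda\cup\{0\}$ otherwise; let $\Lambda^\circ$ be the set of limits $r\in\mathbb R$ of strictly increasing sequences in $\Lambda$. A $\Lambda$-perfect type is a pair $(c,r)$ with $r\in\Lambda^{+0}$,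 or $(o,r)$ with $r\in\Lambda^\circ$; if $\Lambda$ is unbounded, $(o,\infty)$ is also allowed, $\mathrm B^o(a,\infty)=\mathbb U_\Lambda$. The ball $\mathrm B^\epsilon(a,r)$ has type $(\epsilon,r)$. The subgroups $\mathbb I\{\mathrm B_j\}$ are open, so $\mathbb I\{\mathrm B_j\}\backslash\mathbb I_\Lambda$ is countable; the quasiregular representation is the action of $\mathbb I_\Lambda$ on $\ell^2(\mathbb I\{\mathrm B_j\}\backslash\mathbb I_\Lambda)$ by translations. *)

(* Defs.v *)
From HB Require Import structures.
From mathcomp Require Import all_boot all_order all_algebra.
From mathcomp Require Import complex.
From mathcomp Require Import all_classical all_reals all_analysis.

Set Implicit Arguments.
Unset Strict Implicit.
Unset Printing Implicit Defensive.

Import Order.TTheory GRing.Theory Num.Theory.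
Import numFieldNormedType.Exports.

Local Open Scope classical_set_scope.
Local Open Scope ring_scope.
Local Open Scope complex_scope.

Section Urysohn.
Variable R : realType.
Implicit Type Lambda : set R.

Definition is_ultrametric (T : Type) (d : T -> T -> R) : Prop :=
  [/\ forall x y, d x y = 0 <-> x = y,
      forall x y, d x y = d y x &
      forall x y z, d x z <= Num.max (d x y) (d y z)].

Definition spectrum (T : Type) (d : T -> T -> R) : set R :=
  [set r | r != 0 /\ exists x y, d x y = r].

Definition separable_space (T : topologicalType) : Prop :=
  exists2 A : set T, countable A & dense A.

Definition complete_space (T : uniformType) : Prop :=
  forall F : set_system T, ProperFilter F -> cauchy F -> exists l : T, F --> l.

(** A subspace [X] of the finite space [Y] may be empty, so that an isometric
    embedding of [X] is a function on the subtype rather than on [Y]; taking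
    [X] empty and [Y] a point shows that [U] is inhabited. *)
Definition finite_extension_property Lambda (U : metricType R) : Prop :=
  forall (Y : finType) (dY : Y -> Y -> R) (X : pred Y) (f : {y | X y} -> U),
    is_ultrametric dY -> spectrum dY `<=` Lambda ->
    (forall x x', mdist (f x) (f x') = dY (sval x) (sval x')) ->
    exists g : Y -> U,
      (forall y y', mdist (g y) (g y') = dY y y') /\
      (forall x, g (sval x) = f x).

Definition is_urysohn Lambda (U : metricType R) : Prop :=
  [/\ is_ultrametric (@mdist R U),
      complete_space U,
      separable_space U,
      spectrum (@mdist R U) = Lambda &
      finite_extension_property Lambda U].

Variant ball_kind := closed_kind | open_kind.

Definition ball_of (U : metricType R) (a : U) (t : ball_kind * \bar R) :
    set U :=
  match t with
  | (closed_kind, r) => [set x | ((mdist a x)%:E <= r)%E]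
  | (open_kind, r) => [set x | ((mdist a x)%:E < r)%E]
  end.

Definition Lambda_plus0 Lambda : set R :=
  if `[< limit_point Lambda 0 >] then Lambda else Lambda `|` [set 0].

Definition Lambda_circ Lambda : set R :=
  [set r | exists u : R^nat,
    [/\ forall n, Lambda (u n), increasing_seq u & u @ \oo --> r]].

Inductive perfect_type Lambda : ball_kind * \bar R -> Prop :=
| PerfectClosed r of Lambda_plus0 Lambda r :
    perfect_type Lambda (closed_kind, r%:E)
| PerfectOpen r of Lambda_circ Lambda r :
    perfect_type Lambda (open_kind, r%:E)
| PerfectInfty of ~ has_ubound Lambda :
    perfect_type Lambda (open_kind, +oo%E).

End Urysohn.

Section Isometries.
Variables (R : realType) (U : metricType R).

Record isometries : Type := Isometry {
  isometry_fun :> U -> U;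
  isometry_bij : bijective isometry_fun;
  isometry_dist : forall x y,
    mdist (isometry_fun x) (isometry_fun y) = mdist x y }.

Lemma isometriesP (f g : isometries) : f =1 g -> f = g.
Proof.
case: f g => [f fb fd] [g gb gd] /= /funext fg; subst g.
by congr Isometry; exact: Prop_irrelevance.
Qed.

Definition isometry_id : isometries :=
  @Isometry idfun (Bijective (frefl _) (frefl _)) (fun _ _ => erefl).

Lemma isometry_comp_dist (f g : isometries) x y :
  mdist ((f \o g) x) ((f \o g) y) = mdist x y.
Proof. by rewrite /= !isometry_dist. Qed.

Definition isometry_comp (f g : isometries) : isometries :=
  Isometry (ssrfun.bij_comp (isometry_bij f) (isometry_bij g))
           (isometry_comp_dist f g).

Lemma isometry_has_inv (f : isometries) :
  exists g : isometries, cancel f g /\ cancel g f.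
Proof.
have [g fK gK] := isometry_bij f.
have gd x y : mdist (g x) (g y) = mdist x y by rewrite -(isometry_dist f) !gK.
by exists (Isometry (Bijective gK fK) gd).
Qed.

Definition isometry_inv (f : isometries) : isometries :=
  sval (cid (isometry_has_inv f)).

Lemma isometry_funK f : cancel (isometry_fun f) (isometry_inv f).
Proof. exact: (svalP (cid (isometry_has_inv f))).1. Qed.

Lemma isometry_invK f : cancel (isometry_inv f) (isometry_fun f).
Proof. exact: (svalP (cid (isometry_has_inv f))).2. Qed.

HB.instance Definition _ := gen_eqMixin isometries.
HB.instance Definition _ := gen_choiceMixin isometries.

Let compA : associative isometry_comp.
Proof. by move=> f g h; exact: isometriesP. Qed.

Let comp1f : left_id isometry_id isometry_comp.
Proof. by move=> f; exact: isometriesP. Qed.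

Let compf1 : right_id isometry_id isometry_comp.
Proof. by move=> f; exact: isometriesP. Qed.

Let compVf : left_inverse isometry_id isometry_inv isometry_comp.
Proof. by move=> f; apply: isometriesP => x /=; rewrite isometry_funK. Qed.

Let compfV : right_inverse isometry_id isometry_inv isometry_comp.
Proof. by move=> f; apply: isometriesP => x /=; rewrite isometry_invK. Qed.

HB.instance Definition _ :=
  isGroup.Build isometries compA comp1f compf1 compVf compfV.

(** Pointwise convergence with respect to the metric topology of [U]. *)
HB.instance Definition _ := Topological.copy isometries
  (initial_topology (isometry_fun : isometries -> {ptws U -> U})).

Definition ball_stabilizer n (B : 'I_n -> set U) : set isometries :=
  [set g | forall j, isometry_fun g @` B j = B j].

End Isometries.

Definition linear_subspace (K : pzRingType) (V : lmodType K) (W : set V) :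
    Prop :=
  W 0 /\ forall (c : K) (u v : V), W u -> W v -> W (c *: u + v).

Section Representations.
Variables (R : realType) (U : metricType R).
Variables (H : completeNormedModType R[i]) (dot : {dot H for Num.conj}).

(** The complete norm of [H] is the one induced by the inner product [dot]. *)
Definition is_hilbert : Prop := forall v : H, `|v| ^+ 2 = dot v v.

Definition unitary_operator (u : H -> H) : Prop :=
  [/\ linear u,
      forall v w, dot (u v) (u w) = dot v w &
      forall w, exists v, u v = w].

(** Continuity of every orbit map is continuity for the strong operator
    topology. *)
Definition unitary_representation (rho : isometries U -> H -> H) : Prop :=
  [/\ forall g, unitary_operator (rho g),
      forall g h v, rho (g * h)%g v = rho g (rho h v) &
      forall v, continuous (fun g => rho g v)].

Definition irreducible_representation (rho : isometries U -> H -> H) : Prop :=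
  (exists v : H, v != 0) /\
  forall W : set H, linear_subspace W -> closed W ->
    (forall g v, W v -> W (rho g v)) -> W = [set 0] \/ W = setT.

End Representations.

Section Quasiregular.
Variables (R : realType) (G : groupType) (K : set G).

(** The homogeneous space [K\G], as the set of right cosets [K g]. *)
Definition right_cosets : set (set G) :=
  [set A | exists g, A = [set (k * g)%g | k in K]].

Lemma right_cosets_translate (A : right_cosets) (g : G) :
  right_cosets [set (a * g)%g | a in set_val A].
Proof.
have [h /= ->] : right_cosets (set_val A) by exact: set_valP.
exists (h * g)%g; apply/seteqP; split => x /=.
- by move=> [_ [k Kk <-] <-]; exists k => //; rewrite mulgA.
- by move=> [k Kk <-]; exists (k * h)%g; [exists k | rewrite mulgA].
Qed.

(** [SigSub] builds the point of the subtype [right_cosets]; the group acts on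
    the right, [(K h) g = K (h g)], which makes [quasiregular] below a left
    action on functions. *)
Definition coset_translate (A : right_cosets) (g : G) : right_cosets :=
  SigSub (mem_set (right_cosets_translate A g)).

Definition ell2_sqnorm (f : right_cosets -> R[i]^o) : \bar R :=
  \esum_(A in [set: right_cosets]) (complex.Re (`|f A| ^+ 2))%:E.

Definition ell2 : set (right_cosets -> R[i]^o) :=
  [set f | (ell2_sqnorm f < +oo)%E].

Definition ell2_closed (W : set (right_cosets -> R[i]^o)) : Prop :=
  forall f, ell2 f ->
    (forall e : R, 0 < e -> exists2 h, W h & (ell2_sqnorm (f - h)%R < e%:E)%E) ->
    W f.

Definition quasiregular (g : G) (f : right_cosets -> R[i]^o) :
    right_cosets -> R[i]^o :=
  fun A => f (coset_translate A g).

Definition quasiregular_subrepresentation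
    (W : set (right_cosets -> R[i]^o)) : Prop :=
  [/\ W `<=` ell2, linear_subspace W, ell2_closed W &
      forall g f, W f -> W (quasiregular g f)].

(** By polarization, a linear isometry onto [W] is the same as a linear
    bijection onto [W] preserving inner products. *)
Definition equivalent_to_subrepresentation (H : completeNormedModType R[i])
    (rho : G -> H -> H) (W : set (right_cosets -> R[i]^o)) : Prop :=
  exists T : H -> (right_cosets -> R[i]^o),
    [/\ linear T,
        T @` [set: H] = W,
        forall v, ell2_sqnorm (T v) = (complex.Re (`|v| ^+ 2))%:E &
        forall g v, T (rho g v) = quasiregular g (T v)].

End Quasiregular.

(* Main.v *)
(* Write [P_F] for the orthogonal projection on the vectors fixed by the
   stabilizer of a finite family [F] of balls. Continuity and averaging give an
   [F] with [P_F <> 0]. By homogeneity of the Urysohn space,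
   [P_F' P_F = P_(F /\ F')], where the balls of [F /\ F'] are the smallest
   ones containing a ball of [F] and a ball of [F']. Take [F] with [P_F <> 0]
   and the least number [n] of balls; irreducibility makes [F /\ g F'] again
   such a family for some [g], for any two of them. Enlarging the balls along a
   chain leads to a family of [n] balls whose radii are as large as possible:
   along a suitable chain the fixed vectors are eventually constant, so they
   survive in the limit. For this [F], the spaces [P_F H] and [g P_F H] are
   orthogonal unless [g] permutes the balls of [F]. Hence for [v] in [P_F H] the
   vectors [rho (x^-1) v], for [x] in [K \ G] and [K] the stabilizer of [F],
   form a frame whose frame operator has an eigenvector. By Schur's argument it
   is scalar, and [w |-> ('[rho x w, v])_x] is a multiple of an isometry. *)
Require Import Defs.
From mathcomp Require Import all_boot all_order all_algebra.
From mathcomp Require Import complex ring lra.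
From mathcomp Require Import all_classical all_reals all_analysis.
Import Order.TTheory GRing.Theory Num.Theory.
Import numFieldNormedType.Exports.

Set Implicit Arguments.
Unset Strict Implicit.
Unset Printing Implicit Defensive.

Local Open Scope classical_set_scope.
Local Open Scope ring_scope.
Local Open Scope complex_scope.

(** * Homogeneity of the Urysohn space *)

(** Enlarging balls enlarges the stabilizer and shrinks the space of fixed vectors, so an increasing
    chain of families might lose all of them in the limit; this is the main obstacle. Radii of two
    families are comparable only up to a permutation of the balls, so maximality is measured by
    counting, for each lower set [y], the balls of radius at least [y]. The counts are bounded by
    [n], and countability of [Lambda] lets one sequence maximize them for all [y]. Minimality of [n]
    makes the balls of a supporting family disjoint, so that a meet pairs the balls of two families
    bijectively. Maximality of the radii leaves only finitely many translates of [v] not orthogonal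
    to the vectors fixed by [K], one per permutation at most; the eigenvector then comes from a
    finite Hermitian matrix. Stabilizers are in general not compact, so averaging means taking the
    vector of least norm in the closed convex hull of an orbit. *)

Section UltrametricBasics.
Variables (R : realType) (Lambda : set R) (U : metricType R).
Hypothesis U_urysohn : is_urysohn Lambda U.
Local Notation d := (@mdist R U).

Lemma mdist_ultra (x y z : U) : d x z <= Num.max (d x y) (d y z).
Proof. by have [[_ _]] := U_urysohn. Qed.

Lemma mdist_spectrum (x y : U) : d x y = 0 \/ Lambda (d x y).
Proof.
have [_ _ _ <- _] := U_urysohn.
by have [->|/eqP xy] := eqVneq (d x y) 0; [left|right; split; [exact/eqP|exists x, y]].
Qed.

(** The extension property concerns genuine ultrametrics, whereas families of points may repeat.
    Identifying points at [D]-distance 0 reduces to it. *)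
Lemma pseudo_ultrametric_extension (I : finType) (D : I -> I -> R)
    (X : pred I) (f : I -> U) :
  (forall i, D i i = 0) -> (forall i j, D i j = D j i) ->
  (forall i j k, D i k <= Num.max (D i j) (D j k)) ->
  (forall i j, D i j = 0 \/ Lambda (D i j)) ->
  {in X &, forall i j, d (f i) (f j) = D i j} ->
  exists g : I -> U, (forall i j, d (g i) (g j) = D i j) /\ {in X, g =1 f}.
Proof.
move=> D0 Dsym Dtri Dval fX.
have Dge0 i j : 0 <= D i j.
  by have := Dtri i j i; rewrite D0 (Dsym j i) maxxx.
have D0r i j k : D i j = 0 -> D i k = D j k.
  move=> Dij; apply/eqP; rewrite eq_le; apply/andP; split.
  - by rewrite (le_trans (Dtri i j k))// Dij max_r.
  - by rewrite (le_trans (Dtri j i k))// Dsym Dij max_r.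
(* The representative lies in [X] whenever the class of [i] meets [X], so that the prescribed values
   survive the quotient. *)
pose c i := if [pick j | X j && (D i j == 0)] is Some j then j
            else odflt i [pick j | D i j == 0].
have cE i : D i (c i) = 0.
  rewrite /c; case: pickP => [j /andP[_ /eqP//]|_].
  by case: pickP => [j /eqP//|] /=.
have cX i : X i -> X (c i).
  move=> Xi; rewrite /c; case: pickP => [j /andP[]//|/(_ i)].
  by rewrite Xi D0 eqxx.
have c_eq i j : D i j = 0 -> c i = c j.
  move=> Dij; rewrite /c.
  have -> : [pick k | X k && (D i k == 0)] = [pick k | X k && (D j k == 0)].
    by apply: eq_pick => k /=; rewrite (D0r _ _ k Dij).
  case: pickP => // _.
  have -> : [pick k | D i k == 0] = [pick k | D j k == 0].
    by apply: eq_pick => k /=; rewrite (D0r _ _ k Dij).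
  by case: pickP => [//|/(_ j)]; rewrite D0 eqxx.
have cc i : c (c i) == c i by apply/eqP; apply: esym; apply: c_eq; exact: cE.
pose Y := {i | c i == i}.
pose dY (y y' : Y) := D (val y) (val y').
have [_ _ _ _ ext] := U_urysohn.
have [] := ext Y dY (fun y => X (val y)) (fun y => f (val (sval y))).
- split; last by move=> x y z; exact: Dtri.
  + move=> x y; split; last by move=> ->; exact: D0.
    move=> /c_eq; rewrite (eqP (valP x)) (eqP (valP y)) => xy.
    exact/val_inj.
  + by move=> x y; exact: Dsym.
- move=> r [r0 [x [y xy]]]; move: r0; rewrite -xy /dY.
  by case: (Dval (val x) (val y)) => [->|//]; rewrite eqxx.
- by move=> [x Xx] [x' Xx'] /=; exact: fX.
move=> g [gD gf].
exists (fun i => g (exist _ (c i) (cc i))); split.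
  move=> i j; rewrite gD /dY /=.
  by rewrite -(D0r _ _ _ (cE i)) Dsym -(D0r _ _ _ (cE j)) Dsym.
move=> i Xi /=.
have := gf (exist _ (exist _ (c i) (cc i)) (cX i Xi)) => /= ->.
by apply: mdist_positivity; rewrite fX ?unfold_in ?cX// Dsym cE.
Qed.

End UltrametricBasics.

Section Homogeneity.
Variables (R : realType) (Lambda : set R) (U : metricType R).
Hypothesis U_urysohn : is_urysohn Lambda U.
Local Notation d := (@mdist R U).
Local Notation dtri := (mdist_ultra U_urysohn).

Definition partial_isometry (L : set (U * U)) : Prop :=
  forall p q, L p -> L q -> d p.1 q.1 = d p.2 q.2.

Lemma partial_isometry_cons (L : seq (U * U)) (x y : U) :
  partial_isometry [set` L] -> (forall p, p \in L -> d x p.1 = d y p.2) ->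
  partial_isometry [set` (x, y) :: L].
Proof.
move=> Liso xy p q /=; rewrite !inE.
move=> /predU1P[->|pL] /predU1P[->|qL] /=; rewrite ?mdistxx//.
- exact: xy.
- by rewrite metric_sym xy// metric_sym.
- exact: Liso.
Qed.

Lemma partial_isometry_extend (L : seq (U * U)) (x : U) :
  partial_isometry [set` L] ->
  exists y, partial_isometry [set` (x, y) :: L].
Proof.
move=> Liso.
pose n := size L.
pose pt (i : 'I_n.+1) := (nth (x, x) ((x, x) :: L) i).1.
pose f (i : 'I_n.+1) := (nth (x, x) ((x, x) :: L) i).2.
have [] := @pseudo_ultrametric_extension R Lambda U U_urysohn 'I_n.+1
   (fun i j => d (pt i) (pt j)) (fun i => 0 < i)%N f.
- by move=> i; exact: mdistxx.
- by move=> i j; exact: metric_sym.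
- by move=> i j k; exact: dtri.
- by move=> i j; exact: (mdist_spectrum U_urysohn).
- move=> [[//|i] ilt] [[//|j] jlt] _ _; rewrite /f /pt /=; symmetry.
  by apply: Liso; exact: mem_nth.
move=> g [gD gf]; exists (g ord0).
apply: partial_isometry_cons => // p pL.
have iL : ((index p L).+1 < n.+1)%N by rewrite ltnS index_mem.
have := gD ord0 (Ordinal iL); rewrite (gf (Ordinal iL)) ?unfold_in//.
by rewrite /f /pt /= nth_index// => ->.
Qed.

Lemma partial_isometry_swap (L : seq (U * U)) :
  partial_isometry [set` L] ->
  partial_isometry [set` [seq (p.2, p.1) | p <- L]].
Proof.
by move=> Liso p q /= /mapP[p' p'L ->] /mapP[q' q'L ->] /=; apply/esym/Liso.
Qed.

(** The back-and-forth step; its second half is the first one applied to the swapped pairs. *)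
Lemma partial_isometry_extend2 (L : seq (U * U)) (x : U) :
  partial_isometry [set` L] ->
  exists L' : seq (U * U), [/\ partial_isometry [set` L'], {subset L <= L'},
    exists y, (x, y) \in L' & exists y, (y, x) \in L'].
Proof.
move=> Liso; have [y yL] := partial_isometry_extend x Liso.
have [z zL] := partial_isometry_extend x (partial_isometry_swap yL).
exists ((z, x) :: (x, y) :: L); split.
- have := partial_isometry_swap zL; rewrite /= -map_comp map_id_in//.
  by case.
- by move=> p pL; rewrite !inE pL !orbT.
- by exists y; rewrite !inE eqxx orbT.
- by exists z; rewrite !inE eqxx.
Qed.

Lemma ge0_le_max_eps (a b : R) :
  0 <= b -> (forall e, 0 < e -> a <= Num.max e b) -> a <= b.
Proof.
move=> b0 h; apply/ler_addgt0Pr => e e0.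
by rewrite (le_trans (h _ e0))// ge_max lerDr lerDl b0 ltW.
Qed.

(** The closure of [L] in [U * U]. It is the graph of an isometry once [L] is a partial isometry
    with both projections dense. *)
Definition closure_graph (L : set (U * U)) (x y : U) : Prop :=
  forall e, 0 < e -> exists2 p, L p & d x p.1 < e /\ d y p.2 < e.

Lemma closure_graph_swap (L : set (U * U)) x y :
  closure_graph L x y -> closure_graph [set p | L (p.2, p.1)] y x.
Proof.
by move=> h e e0; have [[a b] Lp [? ?]] := h e e0; exists (b, a).
Qed.

Lemma closure_graph_le (L : set (U * U)) (x y x' y' : U) :
  partial_isometry L -> closure_graph L x y -> closure_graph L x' y' ->
  d x x' <= d y y'.
Proof.
move=> Liso xy x'y'; apply: ge0_le_max_eps => [|e e0]; first exact: mdist_ge0.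
have [p Lp [xp yp]] := xy e e0; have [q Lq [xq yq]] := x'y' e e0.
rewrite (le_trans (dtri x p.1 x'))// ge_max le_max (ltW xp)/=.
rewrite (le_trans (dtri p.1 q.1 x'))// ge_max; apply/andP; split; last first.
  by rewrite le_max metric_sym (ltW xq).
rewrite (Liso p q)// (le_trans (dtri p.2 y q.2))// ge_max; apply/andP; split.
  by rewrite le_max metric_sym (ltW yp).
rewrite (le_trans (dtri y y' q.2))// ge_max le_max lexx orbT/=.
by rewrite le_max (ltW yq).
Qed.

Lemma closure_graph_isometry (L : set (U * U)) (x y x' y' : U) :
  partial_isometry L -> closure_graph L x y -> closure_graph L x' y' ->
  d x x' = d y y'.
Proof.
move=> Liso xy x'y'; apply/eqP; rewrite eq_le (closure_graph_le Liso)//=.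
apply: (@closure_graph_le [set p | L (p.2, p.1)]).
- by move=> p q Lp Lq; have := Liso _ _ Lp Lq.
- exact: closure_graph_swap.
- exact: closure_graph_swap.
Qed.

(** Since [L] preserves distances, the second components of pairs whose first component tends to [x]
    form a Cauchy filter. *)
Lemma closure_graph_total (L : set (U * U)) (x : U) :
  partial_isometry L ->
  (forall e, 0 < e -> exists2 p, L p & d x p.1 < e) ->
  exists y, closure_graph L x y.
Proof.
move=> Liso Ld; have [_ cpl _ _ _] := U_urysohn.
pose B (e : R) := [set y | exists2 p, L p /\ p.2 = y & d x p.1 < e].
pose F := filter_from [set e : R | 0 < e] B.
have FF : Filter F.
  apply: filter_from_filter; first by exists 1 => /=.
  move=> e e' /= e0 e'0; exists (Num.min e e') => /=.
    by rewrite lt_min e0.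
  by move=> y [p Lp]; rewrite lt_min => /andP[? ?]; split; exists p.
have PF : ProperFilter F.
  apply: filter_from_proper => e e0; have [p Lp xp] := Ld e e0.
  by exists p.2, p.
have [|l Fl] := cpl F PF.
  apply: cauchy_exP => e e0; have [p Lp xp] := Ld e e0.
  exists p.2; exists e => // y [q [Lq <-] xq].
  rewrite ballEmdist /= -(Liso p q)// (le_lt_trans (dtri p.1 x q.1))//.
  by rewrite gt_max metric_sym xp xq.
exists l => e e0.
have /Fl [e' /= e'0 sub] : nbhs l (ball l e) by exact: nbhsx_ballx.
have [|p Lp xp] := Ld (Num.min e e'); first by rewrite lt_min e0.
move: xp; rewrite lt_min => /andP[xp xp'].
exists p => //; split=> //.
have : ball l e p.2 by apply: sub; exists p.
by rewrite ballEmdist.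
Qed.

(** Back and forth along a dense sequence [e]: the union of the finite partial isometries has dense
    domain and range, and its closure is the isometry. *)
Theorem homogeneity (I : finType) (p q : I -> U) :
  (forall i j, d (p i) (p j) = d (q i) (q j)) ->
  exists g : isometries U, forall i, g (p i) = q i.
Proof.
move=> pq.
have [_ _ [A Acount Adense] _ ext] := U_urysohn.
(* A default value for enumerating the dense set, which may be finite. *)
have [x0 _] : exists x0 : U, True.
  have [] := ext unit (fun _ _ => 0) xpred0 (fun y => match notF (svalP y) with end).
  - by split=> [[] []//||] *; rewrite ?maxxx.
  - by move=> r [r0 [x [y]]] h; rewrite h eqxx in r0.
  - by case.
  - by move=> g _; exists (g tt).
have [e eA] : exists e : nat -> U, forall x, A x -> exists n, e n = x.
  have /countable_injP[h hinj] := Acount.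
  have hE n : exists x, (exists y, A y /\ h y = n) -> A x /\ h x = n.
    have [[y Ay]|nh] := pselect (exists y, A y /\ h y = n); first by exists y.
    by exists x0.
  exists (fun n => sval (cid (hE n))) => x Ax; exists (h x).
  case: cid => y /= /(_ (ex_intro _ x (conj Ax erefl))) [Ay hxy].
  by apply: hinj; rewrite ?inE.
have dense_e x (r : R) : 0 < r -> exists n, d x (e n) < r.
  move=> r0; have ne : (ball x r)° !=set0 by exists x; apply: nbhsx_ballx.
  have [y [+ Ay]] := Adense _ ne (open_interior _).
  move=> /interior_subset; rewrite ballEmdist /= => xy.
  by have [n en] := eA y Ay; exists n; rewrite en.
pose T := {L : seq (U * U) | partial_isometry [set` L]}.
have L0iso : partial_isometry [set` [seq (p i, q i) | i : I]].
  by move=> _ _ /= /mapP[i _ ->] /mapP[j _ ->] /=; exact: pq.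
pose L0 : T := exist (fun L : seq (U * U) => partial_isometry [set` L]) _ L0iso.
have step n (L : T) : exists L' : T, [/\ {subset sval L <= sval L'},
    exists y, (e n, y) \in sval L' & exists y, (y, e n) \in sval L'].
  have [L' [Liso sub ? ?]] := partial_isometry_extend2 (e n) (svalP L).
  by exists (exist _ L' Liso).
pose Ls := fix Ls n : T := if n is m.+1 then sval (cid (step m (Ls m)))
                           else L0.
have Lstep n : [/\ {subset sval (Ls n) <= sval (Ls n.+1)},
    exists y, (e n, y) \in sval (Ls n.+1) & exists y, (y, e n) \in sval (Ls n.+1)].
  by rewrite /=; case: cid.
have Lmon m n : (m <= n)%N -> {subset sval (Ls m) <= sval (Ls n)}.
  move=> /subnK <-; elim: (n - m)%N => // k IH s /IH; rewrite addSn.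
  by have [+ _ _] := Lstep (k + m)%N; apply.
pose L := [set s | exists n, s \in sval (Ls n)].
have Liso : partial_isometry L.
  move=> s t [m sm] [n tn]; apply: (svalP (Ls (maxn m n))).
  - exact: Lmon (leq_maxl m n) _ sm.
  - exact: Lmon (leq_maxr m n) _ tn.
have Gf x : exists y, closure_graph L x y.
  apply: closure_graph_total => // r r0; have [n xn] := dense_e x r r0.
  have [_ [y yL] _] := Lstep n; exists (e n, y) => //; by exists n.+1.
have Gb y : exists x, closure_graph L x y.
  have [||x xG] := @closure_graph_total [set s | L (s.2, s.1)] y.
  - by move=> s t Ls' Lt; have := Liso _ _ Ls' Lt.
  - move=> r r0; have [n xn] := dense_e y r r0.
    have [_ _ [x xL]] := Lstep n; exists (e n, x) => //; by exists n.+1.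
  exists x => r r0; have [[a b] ab [h1 h2]] := xG r r0.
  by exists (b, a).
pose f x := sval (cid (Gf x)); pose f' y := sval (cid (Gb y)).
have fG x : closure_graph L x (f x) by rewrite /f; case: cid.
have f'G x : closure_graph L (f' x) x by rewrite /f'; case: cid.
have fiso x y : d (f x) (f y) = d x y.
  exact/esym/(closure_graph_isometry Liso).
have fb : bijective f.
  exists f' => x; apply: mdist_positivity.
  - by rewrite (closure_graph_isometry Liso (f'G (f x)) (fG x)) mdistxx.
  - by rewrite -(closure_graph_isometry Liso (fG (f' x)) (f'G x)) mdistxx.
exists (Isometry fb fiso) => i /=.
have pqG : closure_graph L (p i) (q i).
  move=> r r0; exists (p i, q i); last by rewrite /= !mdistxx.
  by exists 0; apply/mapP; exists i; rewrite // mem_enum.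
apply: mdist_positivity.
by rewrite -(closure_graph_isometry Liso (fG (p i)) pqG) mdistxx.
Qed.

End Homogeneity.

(** * Families of balls and their meets *)

Section BallFamilies.
Variables (R : realType) (Lambda : set R) (U : metricType R).
Hypothesis U_urysohn : is_urysohn Lambda U.
Local Notation d := (@mdist R U).
Local Notation dtri := (mdist_ultra U_urysohn).
Local Notation G := (isometries U).

(* A ball is encoded by a centre [a] and a lower set [S] of radii, as
   [{x | S (d a x)}]. Open, closed and unbounded balls are thus treated alike,
   and an increasing union of balls is given by the union of the lower sets. *)
Definition lower_set (S : set R) : Prop :=
  S 0 /\ forall q q', S q -> q' <= q -> S q'.

Lemma lower_set_tri (S : set R) (x y z : U) :
  lower_set S -> S (d x y) -> S (d y z) -> S (d x z).
Proof.
by move=> lS Sxy Syz; apply: lS.2 (dtri x y z); case: leP.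
Qed.

Lemma lower_set_gt (S : set R) (q q' : R) :
  lower_set S -> S q -> ~ S q' -> q < q'.
Proof.
by move=> lS Sq nSq'; rewrite ltNge; apply/negP => /(lS.2 _ _ Sq).
Qed.

(** Every point of an ultrametric ball is a centre of it, so keeping the centre inside the ball
    amounts to preserving the ball setwise ([ball_stabilizerE]). *)
Definition family_stabilizer n (a : 'I_n -> U) (S : 'I_n -> set R) : set G :=
  [set g | forall j, S j (d (a j) (g (a j)))].

Lemma isometry_mulE (g h : G) x : (g * h)%g x = g (h x).
Proof. by []. Qed.

Lemma isometry_1E x : (1%g : G) x = x.
Proof. by []. Qed.

Lemma isometry_KV (g : G) x : g (g^-1%g x) = x.
Proof. by rewrite -isometry_mulE mulgV. Qed.

Lemma isometry_distV (g : G) x y : d (g^-1%g x) y = d x (g y).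
Proof. by rewrite -(isometry_dist g) isometry_KV. Qed.

Lemma lower_set_isometryM (S : set R) (g h : G) x :
  lower_set S -> S (d x (g x)) -> S (d x (h x)) -> S (d x (g (h x))).
Proof.
move=> lS Sg Sh; apply: (lower_set_tri lS Sg).
by rewrite isometry_dist.
Qed.

Section Stabilizer.
Variables (n : nat) (a : 'I_n -> U) (S : 'I_n -> set R).
Hypothesis lS : forall j, lower_set (S j).

Lemma family_stabilizer1 : family_stabilizer a S 1%g.
Proof. by move=> j; rewrite isometry_1E mdistxx; have [] := lS j. Qed.

Lemma family_stabilizerM g h : family_stabilizer a S g ->
  family_stabilizer a S h -> family_stabilizer a S (g * h)%g.
Proof. by move=> Sg Sh j; apply: lower_set_isometryM. Qed.

Lemma family_stabilizerV g : family_stabilizer a S g ->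
  family_stabilizer a S g^-1%g.
Proof. by move=> Sg j; rewrite metric_sym isometry_distV. Qed.

Lemma family_stabilizerVM g h :
  family_stabilizer a S (g^-1 * h)%g <-> forall j, S j (d (g (a j)) (h (a j))).
Proof.
suff E j : d (a j) ((g^-1 * h)%g (a j)) = d (g (a j)) (h (a j)).
  by split=> H j; have := H j; rewrite E.
by rewrite isometry_mulE metric_sym isometry_distV metric_sym.
Qed.

End Stabilizer.

(* The radii of the smallest ball containing [B(a j, S j)] and a ball of
   [(b, T)]: the condition at [i] gives the radii of the smallest ball
   containing [B(a j, S j)] and [B(b i, T i)], and these lower sets are
   nested. *)
Definition meet_radius n m (a : 'I_n -> U) (S : 'I_n -> set R)
    (b : 'I_m -> U) (T : 'I_m -> set R) (j : 'I_n) : set R :=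
  [set q | forall i, [\/ S j q, T i q | q <= d (a j) (b i)]].

Definition separated_family n (a : 'I_n -> U) (S : 'I_n -> set R) : Prop :=
  forall i j, i != j -> ~ S i (d (a i) (a j)).

(** General position: [e] pushes [p i] to distance at least [r i] from every [z j], keeping larger
    distances. The last hypothesis on [r] supplies the triangle inequalities of [D] that are not
    inherited from [d]. *)
Lemma escape (I J : finType) (p : I -> U) (z : J -> U) (r : I -> R) :
  (forall i, 0 <= r i) -> (forall i, r i = 0 \/ Lambda (r i)) ->
  (forall i i', r i <= Num.max (d (p i) (p i')) (r i')) ->
  exists e : G, forall i j, d (e (p i)) (z j) = Num.max (d (p i) (z j)) (r i).
Proof.
move=> r0 rL rtri.
pose D (x y : I + J) := match x, y with
  | inl i, inl i' => d (p i) (p i')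
  | inl i, inr j => Num.max (d (p i) (z j)) (r i)
  | inr j, inl i => Num.max (d (p i) (z j)) (r i)
  | inr j, inr j' => d (z j) (z j')
  end.
have [] := @pseudo_ultrametric_extension R Lambda U U_urysohn (I + J)%type D
   (fun x => if x is inr _ then true else false)
   (fun x => match x with inl i => p i | inr j => z j end).
- by case=> x /=; rewrite mdistxx.
- by case=> x [] y //=; rewrite metric_sym.
- have pz i i' j : Num.max (d (p i) (z j)) (r i) <=
      Num.max (d (p i) (p i')) (Num.max (d (p i') (z j)) (r i')).
    rewrite ge_max; apply/andP; split.
      by rewrite (le_trans (dtri _ (p i') _))// ge_max !le_max !lexx !orbT.
    by rewrite (le_trans (rtri i i'))// ge_max !le_max !lexx !orbT.
  case=> x [] y [] w /=.
  + exact: dtri.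
  + exact: pz.
  + rewrite (le_trans (dtri _ (z y) _))// ge_max !le_max lexx/=.
    by rewrite (metric_sym (z y)) lexx !orbT.
  + rewrite ge_max; apply/andP; split; last by rewrite !le_max lexx !orbT.
    by rewrite (le_trans (dtri _ (z y) _))// ge_max !le_max !lexx !orbT.
  + by rewrite [leRHS]maxC (metric_sym (p y)); exact: pz.
  + rewrite (le_trans (dtri _ (p y) _))// ge_max !le_max.
    by rewrite (metric_sym (z x)) !lexx !orbT.
  + rewrite ge_max; apply/andP; split; last by rewrite !le_max lexx !orbT.
    rewrite (le_trans (dtri _ (z y) _))// ge_max !le_max (metric_sym (z y)).
    by rewrite !lexx !orbT.
  + exact: dtri.
- have dL := mdist_spectrum U_urysohn.
  by case=> x [] y /=; do ?exact: dL; case: leP => _; do ?exact: dL; exact: rL.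
- by case=> x [] y.
move=> f [fD fz].
have [e eE] := @homogeneity R Lambda U U_urysohn I p (fun i => f (inl i))
  (fun i i' => esym (fD (inl i) (inl i'))).
exists e => i j; have /= zj := fz (inr j) isT.
by rewrite eE -[in LHS]zj fD.
Qed.

Lemma bigmax0P (Q : seq R) (P : pred R) :
  let r := \big[Num.max/0]_(q <- Q | P q) q in
  (r = 0 \/ (r \in Q /\ P r)) /\ forall q, q \in Q -> P q -> q <= r.
Proof.
elim: Q => [|x Q [IH1 IH2]] /=; first by rewrite big_nil; split; [left|].
rewrite big_cons; case: ifP => Px; split.
- case: leP => _; last by right; rewrite inE eqxx.
  by case: IH1 => [|[? ?]]; [left|right; rewrite inE; split => //; apply/orP; right].
- move=> q; rewrite inE => /predU1P[->|qQ] Pq; rewrite le_max ?lexx//.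
  by rewrite IH2// orbT.
- by case: IH1 => [|[? ?]]; [left|right; rewrite inE; split => //; apply/orP; right].
- move=> q; rewrite inE => /predU1P[->|qQ] Pq; first by rewrite Pq in Px.
  exact: IH2.
Qed.

Section Meet.
Variables (n m : nat) (a : 'I_n -> U) (S : 'I_n -> set R).
Variables (b : 'I_m -> U) (T : 'I_m -> set R).
Hypotheses (lS : forall j, lower_set (S j)) (lT : forall i, lower_set (T i)).
Local Notation M := (meet_radius a S b T).

Lemma meet_radius_lower j : lower_set (M j).
Proof.
split=> [i|q q' Mq q'q i].
  by apply: Or31; have [] := lS j.
have [h|h|h] := Mq i.
- by apply: Or31; apply: (lS j).2 h q'q.
- by apply: Or32; apply: (lT i).2 h q'q.
- by apply: Or33; apply: le_trans q'q h.
Qed.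

Lemma meet_radius_sub j : S j `<=` M j.
Proof. by move=> q Sq i; apply: Or31. Qed.

(** A [g] preserving the ball at [b i] displaces [a j] by at most the larger of [d (a j) (b i)] and
    a radius in [T i]. *)
Lemma stabilizer_meet_radius :
  family_stabilizer b T `<=` family_stabilizer a M.
Proof.
move=> g Tg j i; have := dtri (a j) (b i) (g (a j)).
rewrite le_max => /orP[|h]; first exact: Or33.
have := dtri (b i) (g (b i)) (g (a j)); rewrite isometry_dist le_max => /orP[h'|].
  by apply: Or32; apply: (lT i).2 (Tg i) _; apply: le_trans h h'.
by move/(le_trans h); rewrite (metric_sym (b i)); exact: Or33.
Qed.

Hypothesis sep : separated_family b T.

Lemma lower_set_far i (g : G) q x : family_stabilizer b T g -> ~ T i q ->
  d x (b i) < q -> d (g x) (b i) < q.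
Proof.
move=> Tg nTq xq; apply: (le_lt_trans (dtri (g x) (g (b i)) (b i))).
rewrite gt_max isometry_dist xq metric_sym.
exact: lower_set_gt (lT i) (Tg i) nTq.
Qed.

(* A ball [B(a j, S j)] is free when it is strictly smaller than
   [B(a j, M j)]. The isometry [e] moves the points [s t (a j)], for free [j],
   to points at the largest distance allowed by [M j] from all the
   [s t' (a j')] and [h^-1 (s t' (a j'))]. Then [s t (a j)] and
   [e (s t' (a j'))] are as far apart as [s t (a j)] and
   [h (e (s t' (a j')))], so homogeneity yields [c]. *)
Lemma stabilizer_meet_move k (s : 'I_k -> G) (h : G) :
  (forall t, family_stabilizer b T (s t)) -> family_stabilizer a M h ->
  exists e : G, exists2 c : G, family_stabilizer b T e &
    forall t, family_stabilizer a S ((c * s t)^-1 * s t)%g /\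
              family_stabilizer a S ((c * (e * s t))^-1 * (h * (e * s t)))%g.
Proof.
move=> sT hM.
have sM t := stabilizer_meet_radius (sT t).
(* Tested on [Lambda], where all nonzero distances lie: for [j] not free, a distance in [M j] is
   automatically in [S j]. *)
pose free j := `[< exists q, [/\ Lambda q, M j q & ~ S j q] >].
have /choice[w wE] : forall j, exists q, (q = 0 \/ Lambda q) /\
    (free j -> M j q /\ ~ S j q).
  move=> j; have [/asboolP[q [Lq Mq Sq]]|nf] := boolP (free j).
    by exists q; split; [right|].
  by exists 0; split; [left|].
pose Jf := {x : 'I_k * 'I_n | free x.2}.
pose p (x : Jf + 'I_m) := match x with
  inl y => s (val y).1 (a (val y).2) | inr i => b i end.
pose Sg (x : Jf + 'I_m) := match x with
  inl y => M (val y).2 | inr i => T i end.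
pose z (x : 'I_k * 'I_n + 'I_k * 'I_n + 'I_m) := match x with
  | inl (inl y) => s y.1 (a y.2)
  | inl (inr y) => h^-1%g (s y.1 (a y.2))
  | inr i => b i end.
(* A finite stock of radii, whose largest member in [Sg x] replaces a supremum that may not be
   attained. Having the distances of the [z] in [Q] is used in [cross]; having [w j] keeps [r]
   outside [S j] for free [j]. *)
pose Q := [seq d (z i) (z j) | i <- enum xpredT, j <- enum xpredT] ++
          [seq w j | j : 'I_n].
have zQ i j : d (z i) (z j) \in Q.
  by rewrite mem_cat; apply/orP; left; apply: allpairs_f; rewrite mem_enum.
have wQ j : w j \in Q.
  by rewrite mem_cat; apply/orP; right; apply: map_f; rewrite mem_enum.
have QL q : q \in Q -> q = 0 \/ Lambda q.
  rewrite mem_cat => /orP[/allpairsP[[i j] [_ _ ->]]|/mapP[j _ ->]].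
    exact: mdist_spectrum.
  exact: (wE j).1.
pose r x := \big[Num.max/0]_(q <- Q | `[< Sg x q >]) q.
have lSg x : lower_set (Sg x) by case: x => [y|i]; [exact: meet_radius_lower|exact: lT].
have rP x : (r x = 0 \/ (r x \in Q /\ `[< Sg x (r x) >])) /\
    forall q, q \in Q -> `[< Sg x q >] -> q <= r x.
  exact: (bigmax0P Q (fun q => `[< Sg x q >])).
have rmax x q : q \in Q -> Sg x q -> q <= r x.
  by move=> qQ Sq; apply: (rP x).2 => //; apply/asboolP.
have rS x : Sg x (r x).
  by have [[->|[_ /asboolP//]] _] := rP x; exact: (lSg x).1.
have rL x : r x = 0 \/ Lambda (r x).
  by have [[->|[rQ _]] _] := rP x; [left|exact: QL].
have r0 x : 0 <= r x by rewrite /r; elim/big_rec: _ => // q y _ y0; rewrite le_max y0 orbT.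
have r_le x y : Sg y (r x) -> r x <= r y.
  by have [[->//|[rQ _]] _] := rP x; exact: rmax.
have rnS (y : Jf) : ~ S (val y).2 (r (inl y)).
  have [Mw Sw] := (wE (val y).2).2 (valP y).
  by move=> Sr; apply: Sw; apply: (lS _).2 Sr _; apply: rmax.
have far j i q t : ~ T i q -> d (a j) (b i) < q -> d (s t (a j)) (b i) < q.
  exact: lower_set_far.
have notM j q : ~ M j q -> exists i, ~ T i q /\ d (a j) (b i) < q.
  move=> /existsNP[i ni]; exists i; split=> [Tq|].
    by apply: ni; apply: Or32.
  by rewrite ltNge; apply/negP => qd; apply: ni; apply: Or33.
(* If [r x] is outside [Sg y] and exceeds the distance, some [b i] with [~ T i (r x)] is closer than
   [r x] to [p x]. For a point coming from [a] this excludes [r x] from [M]; for a point of [b] it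
   contradicts [sep]. *)
have rtri x y : r x <= Num.max (d (p x) (p y)) (r y).
  rewrite le_max; apply/orP; have [|] := pselect (Sg y (r x)); first by right; exact: r_le.
  move=> nS; left; rewrite leNgt; apply/negP => lt.
  case: x y nS lt => [x|i] [y|i'] nS lt.
  - have [i [nT lti]] := notM _ _ nS.
    have [//| |] := rS (inl x) i; first exact: rnS.
      exact: nT.
    apply/negP; rewrite -ltNge.
    have far2 := far _ _ _ (val y).1 nT lti.
    have far3 : d (s (val x).1 (a (val x).2)) (b i) < r (inl x).
      by apply: le_lt_trans (dtri _ (p (inl y)) _) _; rewrite gt_max lt.
    rewrite -(isometry_dist (s (val x).1)).
    apply: le_lt_trans (dtri _ (b i) _) _; rewrite gt_max far3/=.
    exact: lower_set_gt (lT i) (sT _ i) nT.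
  - have [//| |] := rS (inl x) i'; first exact: rnS.
      exact: nS.
    apply/negP; rewrite -ltNge -(isometry_dist (s (val x).1)).
    apply: le_lt_trans (dtri _ (b i') _) _; rewrite gt_max lt/=.
    exact: lower_set_gt (lT i') (sT _ i') nS.
  - have [k' [nT ltk]] := notM _ _ nS.
    have far2 := far _ _ _ (val y).1 nT ltk.
    have ik : i != k' by apply/eqP => ik; apply: nT; rewrite -ik; exact: (rS (inr i)).
    apply: (sep ik); apply: (lT i).2 (rS (inr i)) _; apply: ltW.
    by apply: le_lt_trans (dtri _ (p (inl y)) _) _; rewrite gt_max lt.
  - have ik : i != i' by apply/eqP => ik; apply: nS; rewrite -ik; exact: (rS (inr i)).
    by apply: (sep ik); apply: (lT i).2 (rS (inr i)) _; apply: ltW.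
have [e eE] := escape z r0 rL rtri.
have eT : family_stabilizer b T e.
  move=> i; rewrite metric_sym; have /= -> := eE (inr i) (inr i).
  by rewrite mdistxx max_r//; exact: (rS (inr i)).
have eM := stabilizer_meet_radius eT.
pose v (x : 'I_k * 'I_n + Jf) := match x with
  | inl y => s y.1 (a y.2) | inr y => e (p (inl y)) end.
pose v' (x : 'I_k * 'I_n + Jf) := match x with
  | inl y => s y.1 (a y.2) | inr y => h (e (p (inl y))) end.
(* As [h] displaces [py] within [M], it can alter only those distances from [py] that lie in [M];
   these are at most [r], so the maximum with [r] hides the change. *)
have cross (x : 'I_k * 'I_n) (y : Jf) :
    d (e (p (inl y))) (s x.1 (a x.2)) = d (h (e (p (inl y)))) (s x.1 (a x.2)).
  have -> : d (h (e (p (inl y)))) (s x.1 (a x.2)) =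
            d (e (p (inl y))) (h^-1%g (s x.1 (a x.2))).
    by rewrite [RHS]metric_sym isometry_distV metric_sym.
  have /= -> := eE (inl y) (inl (inl x)).
  have /= -> := eE (inl y) (inl (inr x)).
  set py := s (val y).1 (a (val y).2); set zx := s x.1 (a x.2).
  have Mh : M (val y).2 (d py (h py)).
    have lM := meet_radius_lower (val y).2.
    apply: (lower_set_tri lM (y := a (val y).2)); first by rewrite metric_sym; exact: sM.
    exact: (lower_set_isometryM lM (hM _) (sM _ _)).
  have pyE : d py (h^-1%g zx) = d (h py) zx.
    by rewrite metric_sym isometry_distV metric_sym.
  have lt1 : d py zx <= Num.max (d py (h^-1%g zx)) (r (inl y)).
    rewrite le_max; apply/orP; have [Md|nMd] := pselect (M (val y).2 (d py zx)).
      by right; apply: rmax => //; exact: (zQ (inl (inl (val y))) (inl (inl x))).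
    left; have := dtri py (h py) zx; rewrite le_max pyE => /orP[le1|//].
    by have := lower_set_gt (meet_radius_lower _) Mh nMd; rewrite ltNge le1.
  have lt2 : d py (h^-1%g zx) <= Num.max (d py zx) (r (inl y)).
    rewrite le_max; apply/orP.
    have [Md|nMd] := pselect (M (val y).2 (d py (h^-1%g zx))).
      by right; apply: rmax => //; exact: (zQ (inl (inl (val y))) (inl (inr x))).
    left; have := dtri (h py) py zx; rewrite le_max -pyE => /orP[|//].
    rewrite (metric_sym (h py)) => le1.
    by have := lower_set_gt (meet_radius_lower _) Mh nMd; rewrite ltNge le1.
  by apply/eqP; rewrite eq_le !ge_max lt1 lt2 !le_max !lexx !orbT.
have [|c cE] := @homogeneity R Lambda U U_urysohn _ v v'.
  case=> [x|x] [y|y] //=.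
  - by rewrite metric_sym cross metric_sym.
  - by rewrite cross.
  - by rewrite !isometry_dist.
exists e, c => // t; split; apply/family_stabilizerVM => j.
  have /= := cE (inl (t, j)) => cs.
  by rewrite cs mdistxx; have [] := lS j.
rewrite !isometry_mulE; have [fj|nfj] := boolP (free j).
  have /= := cE (inr (exist _ (t, j) fj)) => ->.
  by rewrite mdistxx; have [] := lS j.
have lM := meet_radius_lower j.
have [d0|Ld] := mdist_spectrum U_urysohn (c (e (s t (a j)))) (h (e (s t (a j)))).
  by rewrite d0; have [] := lS j.
have Mc : M j (d (a j) (c (a j))).
  have := cE (inl (t, j)) => /= cs.
  apply: (lower_set_tri lM (sM t j)).
  by rewrite -cs isometry_dist metric_sym; exact: sM.
have Me : M j (d (a j) (e (s t (a j)))).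
  exact: (lower_set_isometryM lM (eM j) (sM t j)).
apply: contrapT => nS; move/negP: nfj; apply; apply/asboolP.
eexists; split; [exact: Ld| |exact: nS].
apply: (lower_set_tri lM (y := a j)).
  rewrite metric_sym; exact: (lower_set_isometryM (h := (e * s t)%g) lM Mc).
exact: (lower_set_isometryM (h := (e * s t)%g) lM (hM j)).
Qed.

End Meet.
End BallFamilies.

(** * Orbit means in a Hilbert space *)

Section HilbertSpace.
Variables (R : realType) (H : completeNormedModType R[i]).
Variable dot : {dot H for Num.conj}.
Hypothesis H_hilbert : is_hilbert dot.
Local Notation C := R[i].
Local Notation "''[' u , v ]" := (dot u%R v%R) : ring_scope.

Lemma dotC (u v : H) : '[u, v] = Num.conj '[v, u].
Proof. by rewrite (hermC dot) expr0 mul1r. Qed.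

Lemma dotxx (v : H) : '[v, v] = `|v| ^+ 2.
Proof. by rewrite H_hilbert. Qed.

Lemma dotZr (a : C) (u v : H) : '[u, a *: v] = Num.conj a * '[u, v].
Proof. by rewrite linearZr_LR. Qed.

Lemma dotZl (a : C) (u v : H) : '[a *: u, v] = a * '[u, v].
Proof. by rewrite linearZl_LR. Qed.

Lemma cauchy_schwarz (u v : H) : `|'[u, v]| <= `|u| * `|v|.
Proof.
have [->|v0] := eqVneq v 0; first by rewrite linear0r !normr0 mulr0.
set a := '[u, v]; set b := '[v, v].
have b0 : 0 < b by rewrite /b dotxx exprn_gt0// normr_gt0.
have bE : Num.conj b = b by rewrite conj_Creal// gtr0_real.
have : 0 <= '[b *: u - a *: v, b *: u - a *: v] by rewrite dotxx exprn_ge0.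
rewrite linearBl linearBr linearBr /= !dotZl !dotZr bE -/b -/a (dotC v u) -/a.
have -> : b * (b * '[u, u]) - b * (Num.conj a * a) -
      (a * (b * Num.conj a) - a * (Num.conj a * b)) =
    b * (b * '[u, u] - a * Num.conj a) by ring.
rewrite pmulr_rge0// subr_ge0 -normCK /b !dotxx -exprMn mulrC.
by rewrite ler_sqr ?nnegrE ?mulr_ge0.
Qed.

Lemma parallelogram (u v : H) :
  `|u + v| ^+ 2 + `|u - v| ^+ 2 = (`|u| ^+ 2 + `|v| ^+ 2) *+ 2.
Proof. by rewrite -!dotxx linearDl linearBl !linearDr /= !linearNr /=; ring. Qed.

Lemma ge0_eq0_eps (K c : C) : 0 <= K -> 0 <= c ->
  (forall e : C, 0 < e -> e <= 1 -> c <= e * K) -> c = 0.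
Proof.
move=> K0 c0 h; apply/eqP; rewrite eq_le c0 andbT.
apply/ler_addgt0Pr => e e0; rewrite add0r.
have K1 : 0 < K + 1 + e by rewrite ltr_wpDl// addr_ge0.
apply: le_trans (h (e / (K + 1 + e)) _ _) _.
- by rewrite divr_gt0.
- by rewrite ler_pdivrMr// mul1r lerDr addr_ge0.
- rewrite mulrAC ler_pdivrMr// ler_wpM2l ?ltW//.
  by rewrite -addrA ltrDl ltr_wpDl.
Qed.

Lemma approx_closed (W : set H) :
  (forall z, (forall e : C, 0 < e -> exists2 x, W x & `|z - x| < e) -> W z) ->
  closed W.
Proof.
move=> h z zW; apply: h => e e0.
have [x [Wx]] := zW _ (nbhsx_ballx z e e0).
by rewrite -ball_normE; exists x.
Qed.

Lemma complete_cauchy (x : nat -> H) :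
  (forall e : C, 0 < e -> exists N, forall m n, (N <= m)%N -> (N <= n)%N ->
     `|x m - x n| < e) ->
  exists z, forall e : C, 0 < e ->
    exists N, forall n, (N <= n)%N -> `|z - x n| < e.
Proof.
move=> xc.
have /cvg_ex[z /cvgrPdist_lt xz] : cvg (x @ \oo).
  apply/cauchy_cvgP/cauchy_exP => e e0; have [N NE] := xc e e0.
  exists (x N); exists N => // n /= Nn.
  by rewrite -ball_normE /=; exact: NE.
exists z => e e0; have [N _ NE] := xz e e0.
by exists N => n Nn; apply: NE.
Qed.

Lemma dot_approx (z w : H) (c : C) :
  (forall e : C, 0 < e -> exists2 x, '[x, w] = c & `|z - x| < e) ->
  '[z, w] = c.
Proof.
move=> h; apply/eqP; rewrite -subr_eq0 -normr_eq0 eq_le normr_ge0 andbT.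
apply/ler_addgt0Pr => e e0; rewrite add0r.
have w1 : 0 < `|w| + 1 by rewrite ltr_wpDl.
have [|x <- zx] := h (e / (`|w| + 1)); first by rewrite divr_gt0.
rewrite -linearBl /=; apply: le_trans (cauchy_schwarz _ _) _.
apply: (@le_trans _ _ (e / (`|w| + 1) * `|w|)).
  by rewrite ler_wpM2r// ltW.
by rewrite mulrAC ler_pdivrMr// ler_wpM2l ?ltW// ltrDl.
Qed.

End HilbertSpace.

Section UnitaryRepresentation.
Variables (R : realType) (H : completeNormedModType R[i]).
Variable dot : {dot H for Num.conj}.
Hypothesis H_hilbert : is_hilbert dot.
Variables (G : groupType) (rho : G -> H -> H).
Hypothesis rho_unitary : forall g, unitary_operator dot (rho g).
Hypothesis rhoM : forall g h v, rho (g * h)%g v = rho g (rho h v).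
Local Notation C := R[i].
Local Notation "''[' u , v ]" := (dot u%R v%R) : ring_scope.

Lemma rho_linear g (c : C) u v : rho g (c *: u + v) = c *: rho g u + rho g v.
Proof. by have [/(_ c u v)] := rho_unitary g. Qed.

Lemma rhoD g u v : rho g (u + v) = rho g u + rho g v.
Proof. by rewrite -(scale1r u) rho_linear !scale1r. Qed.

Lemma rho0 g : rho g 0 = 0.
Proof. by apply: (addrI (rho g 0)); rewrite -rhoD !addr0. Qed.

Lemma rhoZ g (c : C) u : rho g (c *: u) = c *: rho g u.
Proof. by rewrite -[c *: u]addr0 rho_linear rho0 addr0. Qed.

Lemma rhoB g u v : rho g (u - v) = rho g u - rho g v.
Proof. by rewrite rhoD -scaleN1r rhoZ scaleN1r. Qed.

Lemma rho_dot g u v : '[rho g u, rho g v] = '[u, v].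
Proof. by have [_ ->] := rho_unitary g. Qed.

Lemma rho1 v : rho 1%g v = v.
Proof.
by have [_ _ /(_ v)[w <-]] := rho_unitary 1%g; rewrite -rhoM mulg1.
Qed.

Lemma rhoK g v : rho g^-1%g (rho g v) = v.
Proof. by rewrite -rhoM mulVg rho1. Qed.

Lemma rhoVK g v : rho g (rho g^-1%g v) = v.
Proof. by rewrite -rhoM mulgV rho1. Qed.

Lemma rho_dotV g u v : '[rho g u, v] = '[u, rho g^-1%g v].
Proof. by rewrite -(rho_dot g^-1%g) rhoK. Qed.

Lemma rho_norm g v : `|rho g v| = `|v|.
Proof.
by apply/eqP; rewrite -(@eqrXn2 _ 2)// -!(dotxx H_hilbert) rho_dot.
Qed.

Definition fixed_vectors (K : set G) : set H :=
  [set v | forall k, K k -> rho k v = v].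

Lemma fixed_vectors_sub (K : set G) : linear_subspace (fixed_vectors K).
Proof.
split=> [k _|c u v fu fv k Kk]; first exact: rho0.
by rewrite rho_linear fu// fv.
Qed.

Lemma fixed_vectorsS (K K' : set G) : K `<=` K' ->
  fixed_vectors K' `<=` fixed_vectors K.
Proof. by move=> KK' v fv k /KK'; exact: fv. Qed.

Lemma fixed_vectors_translate (K : set G) g v :
  fixed_vectors K v -> fixed_vectors [set h | K (g^-1 * h * g)%g] (rho g v).
Proof.
move=> fv h Kh; rewrite -[in RHS](fv _ Kh) -!rhoM.
by rewrite !mulgA mulgV mul1g.
Qed.

(** Midpoints alone, that is dyadic convex combinations, suffice for the parallelogram argument. *)
Inductive orbit_hull (K : set G) (u : H) : H -> Prop :=
| OrbitHullBase g of K g : orbit_hull K u (rho g u)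
| OrbitHullMid x y of orbit_hull K u x & orbit_hull K u y :
    orbit_hull K u (2^-1 *: (x + y)).

Lemma orbit_hull_rho (K : set G) u g x : (forall h, K h -> K (g * h)%g) ->
  orbit_hull K u x -> orbit_hull K u (rho g x).
Proof.
move=> KM; elim => [h Kh|y z _ IHy _ IHz].
  by rewrite -rhoM; apply: OrbitHullBase; exact: KM.
by rewrite rhoZ rhoD; exact: OrbitHullMid.
Qed.

Lemma orbit_hull_dot (K : set G) u x w : fixed_vectors K w ->
  orbit_hull K u x -> '[x, w] = '[u, w].
Proof.
move=> fw; elim => [g Kg|y z _ IHy _ IHz].
  by rewrite -{1}(fw g Kg) rho_dot.
by rewrite dotZl linearDl /= IHy IHz; field.
Qed.

Lemma orbit_hull_near (K : set G) u x (e : C) :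
  (forall g, K g -> `|rho g u - u| <= e) -> orbit_hull K u x -> `|x - u| <= e.
Proof.
move=> Ke; elim => [g Kg|y z _ IHy _ IHz]; first exact: Ke.
have -> : 2^-1 *: (y + z) - u = 2^-1 *: ((y - u) + (z - u)).
  have two : (2%:R : C) != 0 by rewrite pnatr_eq0.
  rewrite addrACA -opprD [in RHS]scalerDr scalerN; congr (_ - _).
  have -> : u + u = 2%:R *: u by rewrite scaler_nat mulr2n.
  by rewrite scalerA mulVf ?scale1r.
rewrite normrZ ger0_norm ?invr_ge0 ?ler0n// ler_pdivrMl ?ltr0n//.
by rewrite (le_trans (ler_normD _ _))// mulr_natl mulr2n lerD.
Qed.

(** Only finitely many elements of [K] enter a point of the hull, which is what homogeneity on
    finite sets can handle. *)
Lemma orbit_hull_span (K : set G) u x : orbit_hull K u x ->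
  exists k (s : 'I_k -> G), (forall t, K (s t)) /\
    forall W : set H, linear_subspace W -> (forall t, W (rho (s t) u)) -> W x.
Proof.
elim => [g Kg|y z _ [k [s [Ks sW]]] _ [k' [s' [Ks' sW']]]].
  by exists 1%N, (fun _ => g); split=> // W _; apply; exact: ord0.
exists (k + k')%N, (fun t : 'I_(k + k') =>
  match fintype.split t with inl i => s i | inr i => s' i end).
split=> [t|W lW Ws]; first by case: fintype.split.
have Wy : W y.
  by apply: sW => // t; have := Ws (unsplit (inl t)); rewrite unsplitK.
have Wz : W z.
  by apply: sW' => // t; have := Ws (unsplit (inr t)); rewrite unsplitK.
rewrite scalerDr; apply: lW.2 => //.
by rewrite -[_ *: z]addr0; apply: lW.2 => //; exact: lW.1.
Qed.

(** Such a [z] is the orthogonal projection of [u] on the vectors fixed by [K], by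
    [orbit_mean_dot]. *)
Definition orbit_mean (K : set G) (u z : H) : Prop :=
  fixed_vectors K z /\
  forall e : C, 0 < e -> exists2 x, orbit_hull K u x & `|z - x| < e.

(* The mean is the vector of least norm in the closed convex hull of the
   orbit: by the parallelogram law a minimizing sequence in a set stable under
   midpoints is a Cauchy sequence. *)
Lemma orbit_mean_exists (K : set G) u : K 1%g ->
  (forall g h, K g -> K h -> K (g * h)%g) -> exists z, orbit_mean K u z.
Proof.
move=> K1 KM.
pose N (x : H) : R := complex.Re (`|x| ^+ 2).
have NE x : `|x| ^+ 2 = (N x)%:C.
  by rewrite /N RRe_real// realE exprn_ge0.
pose E := [set r | exists2 x, orbit_hull K u x & N x = r].
have Eu : orbit_hull K u u by rewrite -{2}(rho1 u); exact: OrbitHullBase.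
have N0 x : 0 <= N x by rewrite -ler0c -NE exprn_ge0.
have Einf : has_inf E.
  by split; [exists (N u); exists u|exists 0 => _ [x _ <-]; exact: N0].
(* By the parallelogram law the left side is [2 N x + 2 N y - N (x + y)], at most
   [4 (inf E + e) - 4 inf E]. *)
have close e x y : orbit_hull K u x -> orbit_hull K u y ->
    N x <= inf E + e -> N y <= inf E + e -> N (x - y) <= 4 * e.
  move=> hx hy lx ly.
  have : inf E <= N (2^-1 *: (x + y)).
    by apply: ge_inf; [exact: Einf.2|exists (2^-1 *: (x + y)) => //; exact: OrbitHullMid].
  have -> : N (2^-1 *: (x + y)) = N (x + y) / 4.
    apply: (@complexI R); rewrite -NE normrZ exprMn NE ger0_norm ?invr_ge0//.
    by rewrite rmorphM /= mulrC; congr (_ * _); rewrite fmorphV rmorph_nat; field.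
  have : N (x + y) + N (x - y) = (N x + N y) *+ 2.
    apply: (@complexI R); rewrite rmorphD rmorphMn rmorphD /= -!NE.
    exact: parallelogram.
  lra.
have [x xE] : exists x : nat -> H, forall n,
    orbit_hull K u (x n) /\ N (x n) <= inf E + n.+1%:R^-1.
  suff /choice[x xE] : forall n, exists y,
    orbit_hull K u y /\ N y <= inf E + n.+1%:R^-1 by exists x.
  move=> n; have n0 : 0 < n.+1%:R^-1 :> R by rewrite invr_gt0.
  have [_ [y hy <-] lt] := inf_adherent n0 Einf.
  by exists y; split => //; exact: ltW.
have small (e : C) : 0 < e -> exists n, forall m y y', (n <= m)%N ->
    orbit_hull K u y -> orbit_hull K u y' ->
    N y <= inf E + m.+1%:R^-1 -> N y' <= inf E + m.+1%:R^-1 -> `|y - y'| < e.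
  move=> e0; have eR : e = (complex.Re e)%:C by rewrite RRe_real// gtr0_real.
  have re0 : 0 < complex.Re e by rewrite -ltcR -eR.
  pose a := complex.Re e ^+ 2 / 5.
  have a0 : 0 < a by rewrite divr_gt0// exprn_gt0.
  exists (Num.truncn a^-1) => m y y' nm hy hy' ly ly'.
  have ma : m.+1%:R^-1 <= a.
    rewrite invf_ple ?posrE// (le_trans (ltW (truncnS_gt _)))// ler_nat//.
  rewrite -ltr_sqr ?nnegrE ?(ltW e0)// NE eR -rmorphXn ltcR.
  apply: le_lt_trans (close a _ _ hy hy' _ _) _.
  - by rewrite (le_trans ly)// lerD2l.
  - by rewrite (le_trans ly')// lerD2l.
  - rewrite /a; have : 0 < complex.Re e ^+ 2 by rewrite exprn_gt0.
    lra.
have le_inv m n : (n <= m)%N -> m.+1%:R^-1 <= n.+1%:R^-1 :> R.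
  by move=> nm; rewrite lef_pV2 ?posrE// ler_nat.
have [|z zE] := @complete_cauchy R H x.
  move=> e /small[n nE]; exists n => m m' nm nm'.
  have [hm lm] := xE m; have [hm' lm'] := xE m'.
  by apply: (nE n) => //; [apply: le_trans lm _|apply: le_trans lm' _];
    rewrite lerD2l le_inv.
exists z; split; last first.
  move=> e e0; have [n nE] := zE e e0; exists (x n); first exact: (xE n).1.
  exact: nE.
move=> k Kk; apply/eqP; rewrite -subr_eq0 -normr_eq0; apply/eqP.
(* The translate [rho k (x m)] is in the hull with the same norm, so it also nearly minimizes and is
   close to [x m]; 3 counts the error terms. *)
apply: (@ge0_eq0_eps _ 3) => // e e0 _.
have [n nE] := small e e0; have [n' n'E] := zE e e0.
pose m := maxn n n'.
have [hm lm] := xE m.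
have -> : rho k z - z = rho k (z - x m) + ((rho k (x m) - x m) + - (z - x m)).
  by rewrite rhoB opprB !subrKA.
have zm : `|z - x m| <= e by rewrite ltW// n'E ?leq_maxr.
rewrite (le_trans (ler_normD _ _))// rho_norm.
have -> : e * 3 = e + (e + e) by ring.
rewrite lerD// (le_trans (ler_normD _ _))// normrN lerD//.
apply/ltW/(nE m); rewrite ?leq_maxl//.
  by apply: orbit_hull_rho => // h; exact: KM.
by rewrite /N rho_norm.
Qed.

Lemma orbit_mean_dot (K : set G) u z w : orbit_mean K u z ->
  fixed_vectors K w -> '[z, w] = '[u, w].
Proof.
move=> [_ zu] fw; apply: dot_approx => // e e0; have [x hx zx] := zu e e0.
by exists x => //; exact: orbit_hull_dot hx.
Qed.

(* The hypothesis makes ['[x, rho h (rho e x)] = '[x, rho e x]] for convex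
   combinations [x] approximating [z], and [rho e z = z]. *)
Lemma orbit_mean_fixed (K0 K1 K2 : set G) u z :
  fixed_vectors K1 u -> orbit_mean K2 u z ->
  (forall k (s : 'I_k -> G) h, (forall t, K2 (s t)) -> K0 h ->
    exists e, exists2 c, K2 e & forall t,
      K1 ((c * s t)^-1 * s t)%g /\ K1 ((c * (e * s t))^-1 * (h * (e * s t)))%g) ->
  fixed_vectors K0 z.
Proof.
move=> fu [fz zu] move_s h Kh.
have K1E x y : K1 (x^-1 * y)%g -> rho y u = rho x u.
  by move=> Kxy; rewrite -{2}(fu _ Kxy) -rhoM mulgA mulgV mul1g.
(* Since [rho h] preserves norms, this orthogonality forces [rho h z = z]. *)
suff zz : '[z, rho h z - z] = 0.
  apply/eqP; rewrite -subr_eq0 -normr_eq0 -sqrf_eq0 -(dotxx H_hilbert).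
  rewrite linearBl /= zz subr0 linearBr /= rho_dot.
  move: zz; rewrite linearBr /= => /eqP; rewrite subr_eq0 => /eqP zz.
  by rewrite (dotC dot) -zz -(dotC dot) subrr.
apply/eqP; rewrite -normr_eq0; apply/eqP.
apply: (@ge0_eq0_eps _ ((`|z| *+ 2 + 1) *+ 2)) => //.
move=> eps eps0 eps1; have [x hx zx] := zu eps eps0.
have [k [s [Ks sW]]] := orbit_hull_span hx.
have [e [c Ke cE]] := move_s k s h Ks Kh.
pose L y := rho h (rho e y) - rho e y.
(* [c] fixes [rho (s t) u] and acts on [rho (e * s t') u] as [h] does, so unitarity of [rho c]
   equates the two inner products. *)
have Ls t t' : '[rho (s t) u, L (rho (s t') u)] = 0.
  rewrite /L -(rhoM e (s t')) -(rhoM h) linearBr /= (K1E _ _ (cE t').2).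
  rewrite (K1E _ _ (cE t).1).
  by rewrite (rhoM c (e * s t')%g) {1}(rhoM c (s t)) rho_dot (K1E _ _ (cE t).1) subrr.
have Lx : '[x, L x] = 0.
  apply: (sW [set y | '[x, L y] = 0]) => [|t].
    split=> [|a y y' /= hy hy']; first by rewrite /= /L !rho0 subrr linear0r.
    rewrite /L !rho_linear opprD addrACA -scalerBr linearDr /= dotZr.
    by rewrite hy hy' mulr0 addr0.
  apply: (sW [set y | '[y, L (rho (s t) u)] = 0]) => [|t'] /=; last exact: Ls.
  split=> [|a y y' /= hy hy']; first by rewrite /= linear0l.
  by rewrite linearDl /= dotZl hy hy' mulr0 addr0.
have Lnorm y : `|L y| <= `|y| *+ 2.
  by rewrite (le_trans (ler_normB _ _))// !rho_norm mulr2n.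
have LB y y' : L (y - y') = L y - L y'.
  by rewrite /L !rhoB !opprB [LHS]addrACA [RHS]addrACA [- _ - _ in LHS]addrC.
have -> : rho h z - z = L z by rewrite /L !(fz e Ke).
clearbody L.
have -> : '[z, L z] = '[z - x, L z] + '[x, L (z - x)].
  by rewrite LB linearBr /= Lx subr0 linearBl /= subrK.
rewrite (le_trans (ler_normD _ _))//.
have xle : `|x| <= `|z| + 1.
  have -> : x = z - (z - x) by rewrite opprB addrC subrK.
  rewrite (le_trans (ler_normB _ _))// lerD2l (le_trans (ltW zx))//.
have -> : eps * ((`|z| *+ 2 + 1) *+ 2) =
    eps * (`|z| *+ 2) + (`|z| + 1) * (eps *+ 2) by ring.
apply: lerD; apply: le_trans (cauchy_schwarz H_hilbert _ _) _.
  by rewrite ler_pM// ltW.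
by rewrite ler_pM// (le_trans (Lnorm _))// lerMn2r ltW.
Qed.

End UnitaryRepresentation.

(** * Supporting families with the largest radii *)

Section FixedVectors.
Variables (R : realType) (Lambda : set R) (U : metricType R).
Variables (H : completeNormedModType R[i]) (dot : {dot H for Num.conj}).
Variable rho : isometries U -> H -> H.
Hypothesis Lambda_countable : countable Lambda.
Hypothesis U_urysohn : is_urysohn Lambda U.
Hypothesis H_hilbert : is_hilbert dot.
Hypothesis rho_unitary : forall g, unitary_operator dot (rho g).
Hypothesis rhoM : forall g h v, rho (g * h)%g v = rho g (rho h v).
Hypothesis rho_irreducible : irreducible_representation rho.
Local Notation d := (@mdist R U).
Local Notation G := (isometries U).
Local Notation "''[' u , v ]" := (dot u%R v%R) : ring_scope.

(** Otherwise the vectors orthogonal to all translates of [u] form a closed invariant subspace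
    containing [x] but not [u]. *)
Lemma translates_total (x u : H) : x != 0 -> u != 0 ->
  exists g, '[x, rho g u] != 0.
Proof.
move=> x0 u0; apply: contrapT => /forallNP nx.
have [_ /(_ [set w | forall g, '[w, rho g u] = 0])[]] := rho_irreducible.
- split=> [g|c v w vW wW g]; first by rewrite linear0l.
  by rewrite linearDl /= dotZl vW wW mulr0 addr0.
- apply: approx_closed => z zW g; apply: dot_approx => // e /zW[y yW zy].
  by exists y.
- by move=> g v vW h; rewrite (rho_dotV rho_unitary rhoM) -rhoM.
- move=> W0; move/eqP: x0; apply.
  have : [set w | forall g, '[w, rho g u] = 0] x.
    by move=> g; apply/eqP/negPn/negP; exact: nx.
  by rewrite W0.
- move=> WT; have : [set w | forall g, '[w, rho g u] = 0] u by rewrite WT.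
  move=> /(_ 1%g); rewrite (rho1 rho_unitary rhoM) (dotxx H_hilbert) => /eqP.
  by rewrite expf_eq0 /= normr_eq0 (negbTE u0).
Qed.

(** Nonzero distances lie in [Lambda], so only the trace of a lower set on [Lambda] affects the
    ball. *)
Definition radius_le (S T : set R) : Prop := Lambda `&` S `<=` T.

Lemma radius_le_trans S T V : radius_le S T -> radius_le T V -> radius_le S V.
Proof. by move=> ST TV q [Lq Sq]; apply: TV; split => //; apply: ST. Qed.

Lemma subset_radius_le S T : S `<=` T -> radius_le S T.
Proof. by move=> ST q [_ /ST]. Qed.

Lemma lower_set_total (S T : set R) : lower_set S -> lower_set T ->
  S `<=` T \/ T `<=` S.
Proof.
move=> lS lT; have [|/existsNP[q /not_implyP[Sq nTq]]] := pselect (S `<=` T).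
  by left.
by right=> r Tr; apply: lS.2 Sq _; apply/ltW/(lower_set_gt lT Tr nTq).
Qed.

Lemma family_stabilizerS n (a : 'I_n -> U) (S T : 'I_n -> set R) :
  (forall j, lower_set (T j)) -> (forall j, radius_le (S j) (T j)) ->
  family_stabilizer a S `<=` family_stabilizer a T.
Proof.
move=> lT ST g Sg j.
have [->|Ld] := mdist_spectrum U_urysohn (a j) (g (a j)).
  by have [] := lT j.
by apply: ST; split => //; exact: Sg.
Qed.

(** The second clause excludes balls reduced to a point when 0 is a limit point of [Lambda], where
    radius 0 is not a perfect type. *)
Definition admissible (S : set R) : Prop :=
  lower_set S /\ (limit_point Lambda 0 -> exists2 q, S q & 0 < q).

Definition family_vectors n (a : 'I_n -> U) (S : 'I_n -> set R) : set H :=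
  fixed_vectors rho (family_stabilizer a S).

Definition supporting_family n (a : 'I_n -> U) (S : 'I_n -> set R) : Prop :=
  (forall j, admissible (S j)) /\ exists2 v, family_vectors a S v & v != 0.

Lemma admissibleS S T : admissible S -> lower_set T -> S `<=` T -> admissible T.
Proof.
move=> [_ aS] lT ST; split => // /aS[q Sq q0].
by exists q => //; exact: ST.
Qed.

Lemma family_vectorsS n (a : 'I_n -> U) (S T : 'I_n -> set R) :
  (forall j, lower_set (T j)) -> (forall j, radius_le (S j) (T j)) ->
  family_vectors a T `<=` family_vectors a S.
Proof. by move=> lT ST; apply: fixed_vectorsS; exact: family_stabilizerS. Qed.

Lemma family_vectors_translate n (a : 'I_n -> U) (S : 'I_n -> set R) (g : G) v :
  family_vectors a S v -> family_vectors (g \o a) S (rho g v).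
Proof.
move=> fv h Sh; apply: (fixed_vectors_translate rhoM fv) => j.
rewrite !isometry_mulE -(isometry_dist g) isometry_KV; exact: Sh.
Qed.

Lemma injective_preim_closed n (s : 'I_n -> 'I_n) (A : {set 'I_n}) :
  injective s -> (forall i, s i \in A -> i \in A) ->
  forall i, i \in A -> s i \in A.
Proof.
move=> inj_s sA i iA; have sub : s @^-1: A \subset A.
  by apply/fintype.subsetP => j; rewrite inE; exact: sA.
have : s @^-1: A == A.
  by rewrite eqEcard sub card_preimset ?leqnn.
by move=> /eqP AE; move: iA; rewrite -{1}AE inE.
Qed.

Definition above n (S : 'I_n -> set R) (y : set R) : {set 'I_n} :=
  [set j | `[< radius_le y (S j) >]]%SET.

Lemma aboveP n (S : 'I_n -> set R) y j :
  reflect (radius_le y (S j)) (j \in above S y).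
Proof. by rewrite inE; exact: asboolP. Qed.

Lemma aboveS n (S T : 'I_n -> set R) y : (forall j, S j `<=` T j) ->
  above S y \subset above T y.
Proof.
move=> ST; apply/fintype.subsetP => j /aboveP yS; apply/aboveP.
by apply: radius_le_trans yS (subset_radius_le _); exact: ST.
Qed.

Lemma above_anti n (S : 'I_n -> set R) y y' : radius_le y y' ->
  above S y' \subset above S y.
Proof.
move=> yy'; apply/fintype.subsetP => j /aboveP yS; apply/aboveP.
exact: radius_le_trans yS.
Qed.

Section Minimal.
Variable n : nat.
Hypothesis n_min : forall m (a : 'I_m -> U) (S : 'I_m -> set R),
  supporting_family a S -> (n <= m)%N.

Lemma supporting_family_separated (a : 'I_n -> U) (S : 'I_n -> set R) :
  supporting_family a S -> separated_family a S.
Proof.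
move=> [aS [v fv v0]].
suff drop i j : i != j -> S j `<=` S i -> ~ S i (d (a i) (a j)).
  move=> i j ij Sij; have [ji|sij] := lower_set_total (aS j).1 (aS i).1.
    exact: drop ij ji Sij.
  by apply: (drop j i); rewrite 1?eq_sym// metric_sym; exact: sij.
case: n a S aS fv n_min i j => [|m] a S aS fv m_min i j; first by case: i.
rewrite eq_sym => ji Sji Sij.
suff /m_min : supporting_family (a \o lift i) (S \o lift i) by rewrite ltnn.
split=> [k|]; first exact: aS.
exists v => //; apply: fixed_vectorsS fv => g Sg k.
have [k' ->|->] := unliftP i k; first exact: Sg.
have [j' jE|jE] := unliftP i j; last by rewrite jE eqxx in ji.
have := Sg j'; rewrite /= -jE => /Sji Sg'.
have lS := (aS i).1.
apply: (lower_set_tri U_urysohn lS Sij).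
apply: (lower_set_tri U_urysohn lS Sg').
by rewrite isometry_dist metric_sym.
Qed.

(** The projection [z] of [x] on the vectors of the translated family is fixed by the stabilizer of
    the meet, and it is nonzero since its product with [rho g u] is that of [x]. By minimality of
    [n] the balls of the meet are disjoint, so they contain distinct balls of the translate. *)
Lemma family_vectors_meet (a a' : 'I_n -> U) (S S' : 'I_n -> set R) x u (g : G) :
  (forall j, admissible (S j)) -> (forall j, admissible (S' j)) ->
  family_vectors a S x -> family_vectors a' S' u -> '[x, rho g u] != 0 ->
  let T := meet_radius a S (g \o a') S' in
  supporting_family a T /\
  (exists2 z, family_vectors a T z & '[x, z] != 0) /\
  exists2 s : 'I_n -> 'I_n, injective s &
    forall j, S' (s j) `<=` T j /\ T j (d (a j) (g (a' (s j)))).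
Proof.
move=> aS aS' fx fu xu T.
have u0 : u != 0.
  apply/eqP => u0; move: xu; rewrite u0 (rho0 rho_unitary) linear0r eqxx//.
have lS j := (aS j).1; have lS' j := (aS' j).1.
have sep' : separated_family (g \o a') S'.
  move=> i j /= ij; rewrite isometry_dist.
  have sup' : supporting_family a' S' by split; [exact: aS'|exists u].
  exact: (supporting_family_separated sup' ij).
have lT j : lower_set (T j) by exact: meet_radius_lower.
have [z zE] := orbit_mean_exists H_hilbert rho_unitary rhoM x
  (family_stabilizer1 (g \o a') lS')
  (@family_stabilizerM _ _ _ U_urysohn _ (g \o a') _ lS').
have fz : family_vectors a T z.
  apply: (orbit_mean_fixed H_hilbert rho_unitary rhoM fx zE) => k s h Ks Kh.
  exact: (stabilizer_meet_move U_urysohn).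
have zu : '[z, rho g u] = '[x, rho g u].
  apply: (orbit_mean_dot H_hilbert rho_unitary zE).
  exact: family_vectors_translate.
have z0 : z != 0 by apply/eqP => z0; move: xu; rewrite -zu z0 linear0l eqxx.
have supT : supporting_family a T.
  split; last by exists z.
  by move=> j; apply: admissibleS (aS j) (lT j) _; exact: meet_radius_sub.
split=> //; split.
  exists z => //; rewrite -(orbit_mean_dot H_hilbert rho_unitary zE zE.1).
  by rewrite (dotxx H_hilbert) expf_eq0 /= normr_eq0.
have sepT := supporting_family_separated supT.
have /choice[s sE] : forall j, exists i,
    S' i `<=` T j /\ T j (d (a j) (g (a' i))).
  move=> j; apply: contrapT => /forallNP ni.
  pose V i q := [\/ S j q, S' i q | q <= d (a j) (g (a' i))].
  have /choice[q qE] : forall i, exists q, V i q /\ ~ T j q.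
    move=> i; apply: contrapT => /forallNP nq; apply: (ni i).
    have VT q : V i q -> T j q.
      by move=> Vq; apply: contrapT => nT; apply: (nq q).
    by split=> [q Sq|]; apply: VT; [apply: Or32|apply: Or33].
  (* The least of the chosen radii lies in every [V k], hence in [T j], against its choice. *)
  case: (@arg_minP _ _ _ j xpredT q isT) => i _ imin.
  apply: (qE i).2 => k; have := imin k isT => le_ik.
  have [h|h|h] := (qE k).1.
  - by apply: Or31; apply: (lS j).2 h le_ik.
  - by apply: Or32; apply: (lS' k).2 h le_ik.
  - by apply: Or33; apply: le_trans le_ik h.
exists s => // j j' ss; apply: contrapT => /eqP jj'.
have [h|h] := lower_set_total (lT j) (lT j').
- apply: (sepT j' j); first by rewrite eq_sym.
  apply: (lower_set_tri U_urysohn (lT j') (sE j').2).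
  by rewrite -ss metric_sym; apply: h; exact: (sE j).2.
- apply: (sepT j j') => //.
  apply: (lower_set_tri U_urysohn (lT j) (sE j).2).
  by rewrite ss metric_sym; apply: h; exact: (sE j').2.
Qed.

Definition supporting_radii (S : 'I_n -> set R) : Prop :=
  exists a : 'I_n -> U, supporting_family a S.

(** [translates_total] makes some translate of the second family meet the first one. The meet keeps
    the centres [a], so enlargements can be iterated into a chain. *)
Lemma supporting_family_enlarge (a : 'I_n -> U) (S S' : 'I_n -> set R) x :
  (forall j, admissible (S j)) -> family_vectors a S x -> x != 0 ->
  supporting_radii S' ->
  exists T, [/\ supporting_family a T, forall j, S j `<=` T j,
    exists2 z, family_vectors a T z & '[x, z] != 0 &
    exists2 s : 'I_n -> 'I_n, injective s & forall j, S' (s j) `<=` T j].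
Proof.
move=> aS fx x0 [a' [aS' [u fu u0]]].
have [g xu] := translates_total x0 u0.
have [supT [zT [s inj_s sT]]] := family_vectors_meet aS aS' fx fu xu.
eexists; split; [exact: supT| |exact: zT|].
- by move=> j; exact: meet_radius_sub.
- by exists s => // j; exact: (sT j).1.
Qed.

Lemma above_reindex (S T : 'I_n -> set R) (s : 'I_n -> 'I_n) y :
  (forall j, S (s j) `<=` T j) ->
  forall j, s j \in above S y -> j \in above T y.
Proof.
move=> ST j /aboveP yS; apply/aboveP.
by apply: radius_le_trans yS (subset_radius_le _); exact: ST.
Qed.

Lemma card_above_reindex (S T : 'I_n -> set R) (s : 'I_n -> 'I_n) y :
  injective s -> (forall j, S (s j) `<=` T j) ->
  (#|above S y| <= #|above T y|)%N.
Proof.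
move=> inj_s ST; rewrite -(card_preimset _ inj_s).
apply/subset_leq_card/fintype.subsetP => j; rewrite inE.
exact: above_reindex.
Qed.

Definition saturated (S : 'I_n -> set R) (y : set R) : Prop :=
  forall S', supporting_radii S' -> (#|above S' y| <= #|above S y|)%N.

Lemma saturated_exists y S : supporting_radii S ->
  exists2 S', supporting_radii S' & saturated S' y.
Proof.
move=> supS; pose P k := `[< exists2 S', supporting_radii S' & #|above S' y| = k >].
have exP : exists k, P k by exists #|above S y|; apply/asboolP; exists S.
have leP k : P k -> (k <= n)%N.
  by move=> /asboolP[S' _ <-]; rewrite -[leqRHS]card_ord max_card.
have [k /asboolP[S' supS' <-] kmax] := ex_maxnP exP leP.
by exists S' => // S'' supS''; apply: kmax; apply/asboolP; exists S''.
Qed.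

(* Countably many radii suffice to test saturation: the closed radii in
   [Lambda] and, for each [p], the supremum of the radii attained by [p] balls
   of a supporting family. *)
Lemma saturating_sequence (S0 : 'I_n -> set R) : supporting_radii S0 ->
  exists X : nat -> 'I_n -> set R, (forall k, supporting_radii (X k)) /\
    forall y, lower_set y -> exists k, saturated (X k) y.
Proof.
move=> supS0; have /countable_injP[idx idx_inj] := Lambda_countable.
pose attained y p := exists2 S, supporting_radii S & (p <= #|above S y|)%N.
pose theta p : set R := [set q | exists y, [/\ lower_set y, attained y p & y q]].
pose Y (k : nat + nat) : set R := match k with
  | inl t => [set q | exists q', [/\ Lambda q', idx q' = t & q <= q']]
  | inr p => theta p end.
have Y_cofinal y p : lower_set y -> attained y p ->
    exists2 k, radius_le y (Y k) & attained (Y k) p.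
  move=> ly yp.
  (* Either the supremum [theta p] is itself attained, or some attained lower set contains a radius
     of [Lambda] outside [y], and the closed ball of that radius serves. *)
  have [tp|ntp] := pselect (attained (theta p) p).
    by exists (inr p) => // q [_ yq]; exists y.
  have [ty|] := pselect (radius_le (theta p) y).
    exfalso; apply: ntp; have [S supS pS] := yp; exists S => //.
    by rewrite (leq_trans pS)// subset_leq_card// above_anti.
  move=> /existsNP[q /not_implyP[[Lq [y' [ly' yp' yq']]] nyq]].
  exists (inl (idx q)) => [r [_ yr]|].
    by exists q; split => //; exact/ltW/(lower_set_gt ly yr nyq).
  have [S supS pS] := yp'; exists S => //.
  rewrite (leq_trans pS)// subset_leq_card// above_anti// => r [_ [q' [Lq' qq' rq']]].
  apply: ly'.2 yq' _; rewrite (le_trans rq')//.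
  by rewrite (idx_inj q' q)// inE.
have /choice[X XE] : forall k, exists S, supporting_radii S /\ saturated S (Y k).
  by move=> k; have [S ? ?] := saturated_exists (Y k) supS0; exists S.
exists (fun m => if unpickle m is Some k then X k else S0); split.
  by move=> m; case: unpickle => [k|//]; exact: (XE k).1.
move=> y ly; have [S1 supS1 satS1] := saturated_exists y supS0.
have [//|k yk [S supS Sk]] := Y_cofinal y #|above S1 y| ly; first by exists S1.
exists (pickle k); rewrite pickleK => S' supS'.
rewrite (leq_trans (satS1 _ supS'))// (leq_trans Sk)//.
rewrite (leq_trans ((XE k).2 _ supS))//.
exact/subset_leq_card/above_anti.
Qed.

Lemma saturatedS (S T : 'I_n -> set R) y : (forall j, S j `<=` T j) ->
  saturated S y -> saturated T y.
Proof.
move=> ST sat S' /sat h; rewrite (leq_trans h)//.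
exact/subset_leq_card/aboveS.
Qed.

Lemma saturated_above (S T : 'I_n -> set R) y : (forall j, S j `<=` T j) ->
  saturated S y -> supporting_radii T -> above T y = above S y.
Proof.
move=> ST sat supT; apply/esym/eqP; rewrite eqEcard aboveS//=.
exact: sat.
Qed.

(** Meeting [S k] with a translate of [X k] makes all counts at least those of [X k], so [S k.+1] is
    saturated wherever [X k] is. *)
Lemma saturating_chain (a : 'I_n -> U) (S0 : 'I_n -> set R) :
  supporting_family a S0 ->
  exists S : nat -> 'I_n -> set R, [/\ forall k, supporting_family a (S k),
    forall k l, (k <= l)%N -> forall j, S k j `<=` S l j &
    forall y, lower_set y -> exists k, saturated (S k) y].
Proof.
move=> supS0.
have [|X [supX satX]] := @saturating_sequence S0; first by exists a.
have step k (S : {S | supporting_family a S}) :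
    exists S' : {S | supporting_family a S},
      (forall j, sval S j `<=` sval S' j) /\
      (forall y, (#|above (X k) y| <= #|above (sval S') y|)%N).
  case: S => S supS /=; have [aS [x fx x0]] := supS.
  have [T [supT ST _ [s inj_s sT]]] := supporting_family_enlarge aS fx x0 (supX k).
  exists (exist _ T supT); split => //= y.
  exact: card_above_reindex inj_s sT.
pose S := fix S k : {S | supporting_family a S} :=
  if k is l.+1 then sval (cid (step l (S l))) else exist _ S0 supS0.
have Sstep k : (forall j, sval (S k) j `<=` sval (S k.+1) j) /\
    (forall y, (#|above (X k) y| <= #|above (sval (S k.+1)) y|)%N).
  by rewrite /=; case: cid.
exists (fun k => sval (S k)); split.
- by move=> k; exact: (svalP (S k)).
- move=> k l /subnK <-; elim: (l - k)%N => [|m IH] j q //.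
  by move=> /IH; rewrite addSn; exact: (Sstep _).1.
- move=> y /satX[k sat]; exists k.+1 => S' /sat h.
  by rewrite (leq_trans h)//; exact: (Sstep k).2.
Qed.

Lemma family_vectors_orthogonal (a : 'I_n -> U) (S T : 'I_n -> set R) x :
  (forall j, lower_set (T j)) -> (forall j, S j `<=` T j) ->
  family_vectors a S x -> ~ family_vectors a T x ->
  exists y, [/\ family_vectors a S y, y != 0 &
    forall w, family_vectors a T w -> '[y, w] = 0].
Proof.
move=> lT ST fx nfx.
have [z zE] := orbit_mean_exists H_hilbert rho_unitary rhoM x
  (family_stabilizer1 a lT) (@family_stabilizerM _ _ _ U_urysohn _ a _ lT).
exists (x - z); split.
- have fz : family_vectors a S z.
    apply: family_vectorsS zE.1 => // j.
    by apply: subset_radius_le; exact: ST.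
  by move=> k Kk; rewrite (rhoB rho_unitary) fx// fz.
- by rewrite subr_eq0; apply/eqP => xz; apply: nfx; rewrite xz; exact: zE.1.
- move=> w fw; rewrite linearBl /=.
  by rewrite (orbit_mean_dot H_hilbert rho_unitary zE fw) subrr.
Qed.

(* If stationarity fails, the family [S k] meets a translate of a later [S m] in
   a supporting family [T] not containing [S l]. The indices matched by [T] then
   pair a radius [S l j] with a ball that never reaches it, and [T] has more
   balls of radius at least [S l j] than saturation allows. *)
Lemma saturating_chain_stationary (a : 'I_n -> U) (S : nat -> 'I_n -> set R) :
  (forall k, supporting_family a (S k)) ->
  (forall k l, (k <= l)%N -> forall j, S k j `<=` S l j) ->
  (forall y, lower_set y -> exists k, saturated (S k) y) ->
  exists k, forall l, (k <= l)%N ->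
    family_vectors a (S k) `<=` family_vectors a (S l).
Proof.
move=> supS Smon Ssat.
have lS k j : lower_set (S k j) by have [/(_ j)[]] := supS k.
pose dominates j i := forall l, exists m, radius_le (S l i) (S m j).
(* For a pair where ball [j] does not catch up with ball [i]: a stage [kl.2] of ball [i] that is
   never reached, and a stage [kl.1] saturated at that radius. *)
have /choice[f fE] : forall p : 'I_n * 'I_n, exists kl : nat * nat,
    ~ dominates p.1 p.2 ->
    (forall m, ~ radius_le (S kl.2 p.2) (S m p.1)) /\
    saturated (S kl.1) (S kl.2 p.2).
  move=> [j i] /=; have [dom|/existsNP[l /forallNP nl]] := pselect (dominates j i).
    by exists (0, 0).
  by have [k sat] := Ssat _ (lS l i); exists (k, l).
pose k0 := \max_p (f p).1; exists k0 => l k0l x fx.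
apply: contrapT => nfx.
have [|y [fy y0 yl]] := family_vectors_orthogonal (lS l) _ fx nfx.
  exact: Smon.
have /choice[m0 m0E] : forall p : 'I_n * 'I_n, exists m,
    dominates p.1 p.2 -> radius_le (S l p.2) (S m p.1).
  move=> [j i] /=; have [dom|] := pselect (dominates j i); last by exists 0%N.
  by have [m ?] := dom l; exists m.
pose m := maxn l (maxn (\max_p m0 p) (\max_p (f p).2)).
have lm : (l <= m)%N by rewrite leq_maxl.
have m0m p : (m0 p <= m)%N.
  rewrite /m (leq_trans _ (leq_maxr _ _))// (leq_trans _ (leq_maxl _ _))//.
  exact: leq_bigmax.
have f2m p : ((f p).2 <= m)%N.
  rewrite /m (leq_trans _ (leq_maxr _ _))// (leq_trans _ (leq_maxr _ _))//.
  exact: (leq_bigmax (F := fun p => (f p).2)).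
have [aS _] := supS k0.
have [|T [supT ST [z fz yz] [s inj_s sT]]] :=
  supporting_family_enlarge aS fy y0 (S' := S m); first by exists a.
suff lT j : radius_le (S l j) (T j).
  move/eqP: yz; apply; apply: yl; apply: family_vectorsS fz => // j.
  by have [/(_ j)[]] := supT.
have [dom|ndom] := pselect (dominates (s j) j).
  apply: radius_le_trans (subset_radius_le (sT j)).
  apply: radius_le_trans (m0E (s j, j) dom) _.
  by apply: subset_radius_le; exact: Smon.
exfalso; have [nle sat] := fE (s j, j) ndom; move: nle sat => /=.
set y' := S _ j => nle sat0.
have sat : saturated (S k0) y'.
  apply: saturatedS sat0; apply: Smon.
  exact: (leq_bigmax (F := fun p => (f p).1)).
(* Saturation at [k0] makes the balls reaching [y'] the same in [S k0], [S m] and [T]. The injection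
   [s] maps this set into itself, so [s j] reaches [y'], which [nle] forbids. *)
have Tk : above T y' = above (S k0) y'.
  by apply: saturated_above => //; exists a.
have mk : above (S m) y' = above (S k0) y'.
  apply: saturated_above => //; last by exists a.
  by apply: Smon; exact: leq_trans lm.
have ym : j \in above (S m) y'.
  by apply/aboveP; apply: subset_radius_le; exact: (Smon _ _ (f2m (s j, j)) j).
apply: (nle k0); apply/aboveP; rewrite -mk.
apply: injective_preim_closed inj_s _ _ ym => i; rewrite {2}mk -Tk.
exact: above_reindex.
Qed.

(** Only finitely many displacements are involved, so an isometry stabilizing the union stabilizes
    some late stage; by stationarity it fixes the vectors of stage [k0]. *)
Lemma increasing_union_supporting (a : 'I_n -> U) (S : nat -> 'I_n -> set R) :
  (forall k, supporting_family a (S k)) ->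
  (forall k l, (k <= l)%N -> forall j, S k j `<=` S l j) ->
  (forall y, lower_set y -> exists k, saturated (S k) y) ->
  supporting_family a (fun j => \bigcup_k S k j).
Proof.
move=> supS Smon Ssat; have aS k := (supS k).1.
have [k0 k0E] := saturating_chain_stationary supS Smon Ssat.
have lS j : lower_set (\bigcup_k S k j).
  split; first by exists 0%N => //; have [[]] := aS 0%N j.
  by move=> q q' [k _ Sq] q'q; exists k => //; apply: (aS k j).1.2 Sq _.
split=> [j|].
  by apply: admissibleS (aS 0%N j) (lS j) _; exact: bigcup_sup.
have [_ [v fv v0]] := supS k0; exists v => // g Sg.
have /choice[l lE] : forall j, exists l, S l j (d (a j) (g (a j))).
  by move=> j; have [l _ ?] := Sg j; exists l.
pose m := maxn k0 (\max_j l j).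
apply: (k0E m _ v fv); first exact: leq_maxl.
move=> j; apply: (Smon (l j) m) (lE j).
by rewrite /m (leq_trans _ (leq_maxr _ _))// leq_bigmax.
Qed.

Lemma saturated_supporting_family (a : 'I_n -> U) (S0 : 'I_n -> set R) :
  supporting_family a S0 ->
  exists2 S : 'I_n -> set R, supporting_family a S &
    forall y, lower_set y -> saturated S y.
Proof.
move=> /saturating_chain[S [supS Smon Ssat]].
exists (fun j => \bigcup_k S k j); first exact: increasing_union_supporting.
move=> y /Ssat[k]; apply: saturatedS => j; exact: bigcup_sup.
Qed.

(** The meet contains [S], so saturation gives it the same radii and [S (s j)] is below [S j]. As
    [s] permutes a finite set, these inequalities are equalities: [g] permutes the balls. *)
Lemma saturated_meet (a : 'I_n -> U) (S : 'I_n -> set R) u v g :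
  supporting_family a S -> (forall y, lower_set y -> saturated S y) ->
  family_vectors a S u -> family_vectors a S v -> '[u, rho g v] != 0 ->
  exists2 s : 'I_n -> 'I_n, injective s & forall j,
    [/\ S j (d (a j) (g (a (s j)))), radius_le (S (s j)) (S j) &
        radius_le (S j) (S (s j))].
Proof.
move=> supS satS fu fv uv; have aS := supS.1.
have [supT [_ [s inj_s sT]]] := family_vectors_meet aS aS fu fv uv.
move: supT sT; set T := meet_radius _ _ _ _ => supT sT.
have ST j : S j `<=` T j by exact: meet_radius_sub.
have TS j : radius_le (T j) (S j).
  have lT := (supT.1 j).1.
  apply/aboveP; rewrite -(saturated_above ST (satS _ lT)); last by exists a.
  by apply/aboveP; exact: subset_radius_le.
have sS j : radius_le (S (s j)) (S j).
  exact: radius_le_trans (subset_radius_le (sT j).1) (TS j).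
exists s => // j; split=> //.
  have [->|Ld] := mdist_spectrum U_urysohn (a j) (g (a (s j))).
    by have [[]] := aS j.
  by apply: TS; split=> //; exact: (sT j).2.
apply/aboveP; apply: injective_preim_closed inj_s _ _ _ => [i /aboveP h|].
  exact/aboveP/(radius_le_trans h).
by apply/aboveP; exact: subset_radius_le.
Qed.


End Minimal.
End FixedVectors.

(** * From lower sets of radii to perfect types *)

Section PerfectTypes.
Variables (R : realType) (Lambda : set R) (U : metricType R).
Hypothesis Lambda_gt0 : forall r, Lambda r -> 0 < r.
Hypothesis U_urysohn : is_urysohn Lambda U.
Local Notation d := (@mdist R U).

Lemma sup_Lambda_circ (A : set R) : A `<=` Lambda -> A !=set0 ->
  has_ubound A -> (forall r, A r -> exists2 q, A q & r < q) ->
  Lambda_circ Lambda (sup A).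
Proof.
move=> AL A0 ubA nomax; have supA : has_sup A by [].
(* The next term exceeds both the previous one and [sup A] minus a quantity tending to 0. *)
have next (x : R * nat) : exists y : R, A x.1 -> A y /\ (x.1 < y /\
    sup A - x.2.+1%:R^-1 < y).
  have [Ax|] := pselect (A x.1); last by exists 0.
  have [y Ay xy] := nomax _ Ax.
  have e0 : 0 < x.2.+1%:R^-1 :> R by rewrite invr_gt0.
  have [z Az xz] := sup_adherent e0 supA.
  have [yz|zy] := leP y z.
    by exists z => _; split => //; split => //; exact: lt_le_trans yz.
  by exists y => _; split => //; split => //; exact: lt_trans zy.
have [f fE] := choice next; have [u0 Au0] := A0.
pose u := fix u n := if n is m.+1 then f (u m, m) else u0.
have Au n : A (u n) by elim: n => //= n IH; exact: (fE (u n, n) IH).1.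
exists u; split => [n| |]; first exact: AL.
  by apply/increasing_seqP => n; exact: (fE (u n, n) (Au n)).2.1.
rewrite -cvg_shiftS /=; apply/cvgrPdist_lt => e e0.
near=> n; have le_u : u n.+1 <= sup A by apply: ub_le_sup.
have := (fE (u n, n) (Au n)).2.2; rewrite /= ltrBlDr => lt_u.
rewrite ger0_norm ?subr_ge0// ltrBlDl (lt_trans lt_u)// ltrD2l.
by near: n; exact: near_infty_natSinv_lt (PosNum e0).
Unshelve. all: by end_near. Qed.

(** The type is read off from the trace [A] of [S] on [Lambda]: closed at the maximum if there is
    one, closed of radius 0 if [A] is empty, else open at [sup A], or at infinity if [A] is
    unbounded. *)
Lemma admissible_perfect_type (S : set R) : admissible Lambda S ->
  exists2 t, perfect_type Lambda t &
    forall a : U, ball_of a t = [set x | S (d a x)].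
Proof.
move=> [lS aS]; have dL := mdist_spectrum U_urysohn.
pose A := Lambda `&` S.
have [[r [Lr Sr] rmax]|nomax] :=
    pselect (exists2 r, A r & forall q, A q -> q <= r).
  exists (closed_kind, (r%:E)%E).
    apply: PerfectClosed; rewrite /Lambda_plus0.
    by case: ifP => _ //; left.
  move=> a; apply/seteqP; split=> x /=; rewrite lee_fin.
    exact: lS.2 Sr.
  move=> Sd; have [->|Ld] := dL a x; first exact/ltW/Lambda_gt0.
  exact: rmax.
have nomax' r : A r -> exists2 q, A q & r < q.
  move=> Ar; apply: contrapT => nq; apply: nomax; exists r => // q Aq.
  by rewrite leNgt; apply/negP => rq; apply: nq; exists q.
have [A0|/set0P/negP/negPn/eqP A0] := pselect (A !=set0); last first.
  have nlim : ~ limit_point Lambda 0.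
    move=> lim; have [q Sq q0] := aS lim.
    have [y [_ Ly]] := lim _ (nbhsx_ballx 0 q q0).
    rewrite -ball_normE /= sub0r normrN => yq.
    suff : A y by rewrite A0.
    by split => //; apply: lS.2 Sq _; rewrite (le_trans (ler_norm _))// ltW.
  exists (closed_kind, 0%:E).
    apply: PerfectClosed; rewrite /Lambda_plus0.
    by case: asboolP => // _; right.
  move=> a; apply/seteqP; split=> x /=; rewrite lee_fin => h.
    exact: lS.2 lS.1 h.
  have [->//|Ld] := dL a x.
  by have : A (d a x) by []; rewrite A0.
have [ubA|nubA] := pselect (has_ubound A).
  exists (open_kind, (sup A)%:E).
    by apply: PerfectOpen; apply: sup_Lambda_circ => // q [].
  move=> a; apply/seteqP; split=> x /=; rewrite lte_fin.
    by move=> /(sup_gt A0)[q [_ Sq] dq]; apply: lS.2 Sq (ltW dq).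
  move=> Sd; have [q Aq dq] : exists2 q, A q & d a x < q.
    have [->|Ld] := dL a x; last exact: nomax'.
    by have [q Aq] := A0; exists q => //; exact: Lambda_gt0 Aq.1.
  by apply: lt_le_trans dq _; exact: ub_le_sup.
exists (open_kind, +oo%E).
  apply: PerfectInfty => -[M ubM]; apply: nubA; exists M => q [Lq _].
  exact: ubM.
move=> a; apply/seteqP; split=> x /=; last by rewrite ltry.
move=> _; have [q [_ Sq] dq] : exists2 q, A q & d a x < q.
  apply: contrapT => nq; apply: nubA; exists (d a x) => q Aq.
  by rewrite leNgt; apply/negP => dq; apply: nq; exists q.
exact: lS.2 Sq (ltW dq).
Qed.

End PerfectTypes.

(** * A supporting family from strong continuity *)

Section SupportingFamilyExists.
Variables (R : realType) (Lambda : set R) (U : metricType R).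
Variables (H : completeNormedModType R[i]) (dot : {dot H for Num.conj}).
Variable rho : isometries U -> H -> H.
Hypothesis U_urysohn : is_urysohn Lambda U.
Hypothesis H_hilbert : is_hilbert dot.
Hypothesis rho_unitary : unitary_representation dot rho.
Local Notation d := (@mdist R U).
Local Notation G := (isometries U).

(** The basic sets generate a filter converging pointwise to the identity, so one of them is inside
    any given neighbourhood. *)
Lemma nbhs1_isometries (A : set G) : nbhs (1%g : G) A ->
  exists s : seq U, exists2 r : R, 0 < r &
    [set g : G | forall x, x \in s -> d x (g x) < r] `<=` A.
Proof.
move=> [V [[W Wopen VE] V1] WA]; have {V1}W1 : W (1%g : G) by move: V1; rewrite -VE.
have {}WA : isometry_fun (U:=U) @^-1` W `<=` A by rewrite VE.
pose B (p : seq U * R) := [set f : U -> U | forall x, x \in p.1 -> d x (f x) < p.2].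
pose F := filter_from [set p : seq U * R | 0 < p.2] B.
have FF : Filter F.
  apply: filter_from_filter; first by exists ([::], 1); exact: ltr01.
  move=> [s r] [s' r'] /= r0 r'0.
  exists (s ++ s', Num.min r r') => /=; first by rewrite lt_min r0.
  move=> f sf; split=> x /= xs.
    by have := sf x; rewrite /= mem_cat xs lt_min => /(_ isT)/andP[].
  by have := sf x; rewrite /= mem_cat xs orbT lt_min => /(_ isT)/andP[].
have : {ptws, F --> (idfun : U -> U)}.
  apply/pointwise_cvgP => x V' /nbhs_ballP[e /= e0 sub].
  exists ([:: x], e) => //= f xf; apply: sub.
  by rewrite ballEmdist /=; apply: xf; rewrite inE.
have : nbhs ((idfun : U -> U) : {ptws U -> U}) W by exact: open_nbhs_nbhs.
move=> Wnbhs /(_ W Wnbhs)[[s r] /= r0 sub].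
by exists s, r => // g sg; apply: WA; apply: sub.
Qed.

(** By continuity a small stabilizer moves [v] by at most half its norm. The hull of the orbit stays
    that close to [v], so the mean is not 0. *)
Lemma supporting_family_exists (v : H) : v != 0 ->
  exists n (a : 'I_n -> U) (S : 'I_n -> set R), supporting_family Lambda rho a S.
Proof.
move=> v0; have [unit rhoM cont] := rho_unitary.
have e0 : 0 < `|v| / 2 by rewrite divr_gt0// normr_gt0.
have := cont v 1%g _ (nbhsx_ballx (rho 1%g v) _ e0).
move=> /nbhs1_isometries[s [r r0 sub]].
pose n := size s; pose a (i : 'I_n) := tnth (in_tuple s) i.
(* Halving [r] turns the closed condition into the strict bound required, and the radius stays
   positive, as admissibility asks. *)
pose S (_ : 'I_n) := [set q | q <= r / 2].
have r20 : 0 < r / 2 by rewrite divr_gt0.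
have lS j : lower_set (S j).
  by split=> [|q q' /= qr q'q]; [exact: ltW|exact: le_trans qr].
exists n, a, S; split=> [j|].
  by split=> [|_]; [exact: lS|exists (r / 2) => //; exact: lexx].
have [z [fz zv]] := orbit_mean_exists H_hilbert unit rhoM v
  (family_stabilizer1 a lS) (@family_stabilizerM _ _ _ U_urysohn _ a _ lS).
exists z => //; apply/eqP => zz.
have [x hx xz] := zv _ e0.
have xv : `|x - v| <= `|v| / 2.
  apply: orbit_hull_near hx => g Sg.
  have : ball (rho 1%g v) (`|v| / 2) (rho g v).
    apply: sub => y /seq_tnthP[i ->]; apply: le_lt_trans (Sg i) _.
    by rewrite ltr_pdivrMr// ltr_pMr// ltr1n.
  by rewrite -ball_normE /= (rho1 unit rhoM) distrC => /ltW.
have : `|v| < `|v|.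
  have {1}-> : v = (v - x) + x by rewrite subrK.
  rewrite [ltRHS]splitr (le_lt_trans (ler_normD _ _))//.
  apply: ler_ltD; first by rewrite distrC.
  by move: xz; rewrite zz sub0r normrN.
by rewrite ltxx.
Qed.

End SupportingFamilyExists.

(** * Frames *)

Section Frames.
Variables (R : realType) (H : completeNormedModType R[i]).
Variable dot : {dot H for Num.conj}.
Hypothesis H_hilbert : is_hilbert dot.
Local Notation C := R[i].
Local Notation "''[' u , v ]" := (dot u%R v%R) : ring_scope.

Lemma dot_suml (I : Type) (s : seq I) (F : I -> H) w :
  '[\sum_(i <- s) F i, w] = \sum_(i <- s) '[F i, w].
Proof.
by elim/big_rec2: _ => [|i x y _ <-]; rewrite ?linear0l// linearDl.
Qed.

Lemma dot_sumr (I : Type) (s : seq I) (F : I -> H) w :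
  '[w, \sum_(i <- s) F i] = \sum_(i <- s) '[w, F i].
Proof.
by elim/big_rec2: _ => [|i x y _ <-]; rewrite ?linear0r// linearDr.
Qed.

Lemma dot_norm_sym (u v : H) : `|'[u, v]| = `|'[v, u]|.
Proof. by rewrite (dotC dot) norm_conjC. Qed.

Lemma dot_eq0_sym (u v : H) : ('[u, v] == 0) = ('[v, u] == 0).
Proof. by rewrite -normr_eq0 dot_norm_sym normr_eq0. Qed.

(** An eigenvector [r] of the Gram matrix gives [u] with ['[u, e i]] proportional to [r 0 i], hence
    an eigenvector of the frame operator. A nonzero eigenvalue exists as the matrix is not 0, and
    positivity of the operator gives its sign. *)
Lemma eigenvector_exists m (e : 'I_m -> H) :
  (exists i, '[e i, e i] != 0) ->
  exists c : 'I_m -> C, exists2 l : C, 0 < l &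
    let u := \sum_i c i *: e i in
    u != 0 /\ \sum_i '[u, e i] *: e i = l *: u.
Proof.
move=> [i0 ei0]; pose M : 'M[C]_m := \matrix_(j, i) '[e j, e i].
have Mn : M \is normalmx.
  apply/hermitian_normalmx/is_hermitianmxP; rewrite expr0 scale1r.
  by apply/matrixP => i j; rewrite !mxE (dotC dot).
have /orthomx_spectralP ME := Mn.
set P := spectralmx M in ME; set sp := spectral_diag M in ME.
have [k spk] : exists k, sp 0 k != 0.
  apply: contrapT => /forallNP nsp; move/eqP: ei0; apply.
  have -> : '[e i0, e i0] = M i0 i0 by rewrite mxE.
  suff -> : M = 0 by rewrite mxE.
  rewrite ME; suff -> : sp = 0 by rewrite linear0 mulmx0 mul0mx.
  apply/rowP => k; rewrite mxE; apply/eqP; apply: contrapT => /negP h.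
  exact: (nsp k).
have Punit : P \in unitmx by exact: spectral_unit.
pose r := row k P.
have rM : r *m M = sp 0 k *: r.
  rewrite {1}ME !mulmxA /r -row_mul mulmxV// row1 -[_ *m diag_mx _]rowE.
  rewrite row_diag_mx -scalemxAl -rowE; congr (_ *: _).
have r0 : r != 0.
  apply/eqP => r0; have : row k (P *m invmx P) = 0 by rewrite row_mul -/r r0 mul0mx.
  rewrite mulmxV// => /rowP/(_ k); rewrite !mxE eqxx => /eqP.
  by rewrite oner_eq0.
pose u := \sum_i r 0 i *: e i.
have ue i : '[u, e i] = sp 0 k * r 0 i.
  have := congr1 (fun A : 'rV_m => A 0 i) rM; rewrite !mxE => <-.
  by rewrite dot_suml; apply: eq_bigr => j _; rewrite (dotZl dot) !mxE.
have u0 : u != 0.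
  apply/eqP => u0; move/eqP: r0; apply; apply/rowP => i.
  have /esym/eqP := ue i; rewrite u0 linear0l mulf_eq0 (negPf spk) => /eqP ->.
  by rewrite mxE.
exists (fun i => r 0 i), (sp 0 k); last first.
  split => //; rewrite -/u {2}/u scaler_sumr.
  by apply: eq_bigr => i _; rewrite ue scalerA.
have nu : 0 < `|u| ^+ 2 by rewrite exprn_gt0// normr_gt0.
rewrite lt_def spk -(pmulr_lge0 _ nu) -(dotxx H_hilbert) -(dotZl dot) /=.
have -> : sp 0 k *: u = \sum_i '[u, e i] *: e i.
  by rewrite {1}/u scaler_sumr; apply: eq_bigr => i _; rewrite ue scalerA.
rewrite dot_suml; apply: sumr_ge0 => i _.
by rewrite (dotZl dot) (dotC dot (e i)) -normCK exprn_ge0.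
Qed.

Variables (T : choiceType) (e : T -> H).
Definition partial_frame (s : seq T) (w : H) : H :=
  \sum_(A <- s) '[w, e A] *: e A.

Lemma partial_frame_linear s (c : C) u v :
  partial_frame s (c *: u + v) = c *: partial_frame s u + partial_frame s v.
Proof.
rewrite /partial_frame scaler_sumr -big_split /=; apply: eq_bigr => A _.
by rewrite linearDl /= (dotZl dot) scalerDl scalerA.
Qed.

Lemma partial_frame_dot s w :
  '[partial_frame s w, w] = \sum_(A <- s) `|'[w, e A]| ^+ 2.
Proof.
rewrite dot_suml; apply: eq_bigr => A _.
by rewrite (dotZl dot) (dotC dot (e A)) -normCK.
Qed.

Variables (m : nat) (L : C).
Hypothesis e_bound : forall A, `|e A| ^+ 2 <= L.
Hypothesis L_ge0 : 0 <= L.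
Hypothesis e_overlap : forall (s : seq T) A, uniq s ->
  (count (fun B => '[e A, e B] != 0%R) s <= m)%N.

(** Schur's test: the Gram matrix has entries bounded by [L] and at most [m] nonzero ones per
    row. *)
Lemma synthesis_bound (s : seq T) (c : T -> C) : uniq s ->
  `|\sum_(A <- s) c A *: e A| ^+ 2 <= m%:R * L * \sum_(A <- s) `|c A| ^+ 2.
Proof.
move=> us; rewrite -(dotxx H_hilbert) dot_suml.
pose X A B : C := (nat_of_bool ('[e A, e B] != 0%R))%:R.
have Xsym A B : X A B = X B A by rewrite /X dot_eq0_sym.
have bound A B : `|'[c A *: e A, c B *: e B]| <=
    L / 2 * (X A B * `|c A| ^+ 2 + X B A * `|c B| ^+ 2).
  rewrite (dotZl dot) (dotZr dot) !normrM norm_conjC -(Xsym A B) -mulrDr /X.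
  have [->|e0] := eqVneq '[e A, e B] 0.
    by rewrite normr0 /= !mulr0 mul0r mulr0.
  rewrite mul1r.
  have le1 : `|'[e A, e B]| <= L.
    apply: le_trans (cauchy_schwarz H_hilbert _ _) _.
    have [le|le] := real_leP (normr_real (e A)) (normr_real (e B)).
    - by apply: le_trans (e_bound B); rewrite expr2 ler_wpM2r.
    - by apply: le_trans (e_bound A); rewrite expr2 ler_wpM2l// ltW.
  have le2 : `|c A| * `|c B| <= (`|c A| ^+ 2 + `|c B| ^+ 2) / 2.
    rewrite ler_pdivlMr ?ltr0n// -subr_ge0.
    have -> : `|c A| ^+ 2 + `|c B| ^+ 2 - `|c A| * `|c B| * 2 =
      (`|c A| - `|c B|) ^+ 2 by ring.
    by rewrite -realEsqr realB ?normr_real.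
  rewrite mulrA; apply: le_trans (ler_pM _ _ le2 le1) _ => //.
  by rewrite le_eqVlt; apply/orP; left; apply/eqP; ring.
have dotE : \sum_(A <- s) '[c A *: e A, \sum_(B <- s) c B *: e B] =
    \sum_(A <- s) \sum_(B <- s) '[c A *: e A, c B *: e B].
  by apply: eq_bigr => A _; rewrite dot_sumr.
have XE : \sum_(A <- s) \sum_(B <- s) X A B * `|c A| ^+ 2 <=
    m%:R * \sum_(A <- s) `|c A| ^+ 2.
  rewrite mulr_sumr; apply: ler_sum => A _; rewrite -mulr_suml.
  rewrite ler_wpM2r ?exprn_ge0// /X -natr_sum ler_nat.
  apply: leq_trans (e_overlap A us); rewrite -sum1_count [leqRHS]big_mkcond /=.
  by apply: leq_sum => B _; case: eqP.
rewrite dotE -[X in X <= _]ger0_norm; last first.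
  by rewrite -dotE -dot_suml (dotxx H_hilbert) exprn_ge0.
apply: le_trans (ler_norm_sum _ _ _) _.
apply: (@le_trans _ _ (\sum_(A <- s) \sum_(B <- s)
    L / 2 * (X A B * `|c A| ^+ 2 + X B A * `|c B| ^+ 2))).
  apply: ler_sum => A _; apply: le_trans (ler_norm_sum _ _ _) _.
  by apply: ler_sum => B _; exact: bound.
have -> : \sum_(A <- s) \sum_(B <- s)
    L / 2 * (X A B * `|c A| ^+ 2 + X B A * `|c B| ^+ 2) =
    L * \sum_(A <- s) \sum_(B <- s) X A B * `|c A| ^+ 2.
  under eq_bigr => A _ do rewrite -mulr_sumr big_split /=.
  rewrite -mulr_sumr big_split /= [X in _ + X]exchange_big /=.
  by field.
by rewrite -mulrA mulrCA ler_wpM2l.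
Qed.

(** With [F] the partial operator, [synthesis_bound] gives [|F w|^2 <= m L '[F w, w]];
    Cauchy-Schwarz and division by [|F w|] finish. The bound does not depend on [s]. *)
Lemma partial_frame_bound s w : uniq s ->
  `|partial_frame s w| <= m%:R * L * `|w|.
Proof.
move=> us; have [->|f0] := eqVneq (partial_frame s w) 0.
  by rewrite normr0 !mulr_ge0.
have fgt : 0 < `|partial_frame s w| by rewrite normr_gt0.
rewrite -(ler_pM2l fgt) -expr2.
apply: le_trans (synthesis_bound _ us) _; rewrite -partial_frame_dot.
rewrite mulrCA ler_wpM2l ?mulr_ge0//.
apply: le_trans (cauchy_schwarz H_hilbert _ _).
rewrite -[X in X <= _]ger0_norm// partial_frame_dot.
by apply: sumr_ge0 => A _; rewrite exprn_ge0.
Qed.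

(* The frame operator is the limit of its partial sums along the finite sets of
   indices. *)
Definition frame_eigenspace (l : C) : set H :=
  [set w | forall eps : C, 0 < eps -> exists2 s0 : seq T, uniq s0 &
    forall s, uniq s -> {subset s0 <= s} ->
      `|partial_frame s w - l *: w| <= eps].

Lemma uniq_union (s s' : seq T) : exists s2, [/\ uniq s2,
  {subset s <= s2} & {subset s' <= s2}].
Proof.
exists (undup (s ++ s')); split; first exact: undup_uniq.
- by move=> x xs; rewrite mem_undup mem_cat xs.
- by move=> x xs; rewrite mem_undup mem_cat xs orbT.
Qed.

Lemma frame_eigenspace_linear l : linear_subspace (frame_eigenspace l).
Proof.
split=> [eps eps0|c u v uE vE eps eps0].
  exists [::] => // s _ _; rewrite scaler0 subr0.
  rewrite /partial_frame big1 ?normr0 ?ltW// => A _.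
  by rewrite linear0l scale0r.
have c1 : 0 < `|c| + 1 by rewrite ltr_wpDl.
have eps' : 0 < eps / (`|c| + 1) / 2 by rewrite !divr_gt0.
have eps2 : 0 < eps / 2 by rewrite divr_gt0.
have [s us sE] := uE _ eps'; have [s' us' sE'] := vE _ eps2.
have [s2 [us2 ss2 s's2]] := uniq_union s s'.
exists s2 => // t ut st.
rewrite partial_frame_linear scalerDr opprD addrACA.
rewrite scalerA [l * c]mulrC -scalerA -scalerBr.
rewrite (le_trans (ler_normD _ _))// [leRHS]splitr; apply: lerD; last first.
  by apply: sE' => // x /s's2; exact: st.
rewrite normrZ; apply: (@le_trans _ _ (`|c| * (eps / (`|c| + 1) / 2))).
  by rewrite ler_wpM2l// sE// => x /ss2; exact: st.
rewrite mulrA ler_wpM2r ?invr_ge0 ?ler0n// mulrCA ler_piMr ?ltW//.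
by rewrite ltr_pdivrMr// mul1r ltrDl.
Qed.

Lemma frame_eigenspace_closed l : closed (frame_eigenspace l).
Proof.
apply: approx_closed => z zE eps eps0.
pose K := m%:R * L + `|l| + 1 : C.
have K0 : 0 < K by rewrite ltr_wpDl// addr_ge0// mulr_ge0.
have eps2 : 0 < eps / 2 by rewrite divr_gt0.
have eps' : 0 < eps / 2 / K by rewrite divr_gt0.
have [x xE zx] := zE _ eps'; have [s us sE] := xE _ eps2.
exists s => // t ut st.
have -> : partial_frame t z - l *: z =
    (partial_frame t (z - x) - l *: (z - x)) + (partial_frame t x - l *: x).
  have {1 2}-> : z = 1 *: (z - x) + x by rewrite scale1r subrK.
  by rewrite partial_frame_linear !scale1r scalerDr opprD addrACA.
rewrite (le_trans (ler_normD _ _))// [leRHS]splitr; apply: lerD; last exact: sE.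
rewrite (le_trans (ler_normB _ _))// normrZ.
apply: (@le_trans _ _ (K * `|z - x|)).
  rewrite /K !mulrDl -addrA lerD ?partial_frame_bound// mul1r.
  by rewrite lerDl.
by rewrite mulrC -ler_pdivlMr// ltW.
Qed.

(** Parseval's identity as a supremum over finite sets: ['[partial_frame s w, w]] tends to
    [l * |w|^2] and increases with [s]. *)
Lemma frame_eigenspace_sqnorm l w : 0 <= l -> frame_eigenspace l w ->
  (forall s, uniq s -> \sum_(A <- s) `|'[w, e A]| ^+ 2 <= l * `|w| ^+ 2) /\
  forall eps : C, 0 < eps -> exists2 s, uniq s &
    l * `|w| ^+ 2 - eps <= \sum_(A <- s) `|'[w, e A]| ^+ 2.
Proof.
move=> l0 wE.
have w1 : 0 < `|w| + 1 by rewrite ltr_wpDl.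
have near_l (eps : C) : 0 < eps -> exists2 s0 : seq T, uniq s0 &
    forall s, uniq s -> {subset s0 <= s} ->
      `|\sum_(A <- s) `|'[w, e A]| ^+ 2 - l * `|w| ^+ 2| <= eps.
  move=> eps0; have eps' : 0 < eps / (`|w| + 1) by rewrite divr_gt0.
  have [s0 us0 sE] := wE _ eps'; exists s0 => // s us ss.
  rewrite -partial_frame_dot -(dotxx H_hilbert) -(dotZl dot) -linearBl /=.
  apply: le_trans (cauchy_schwarz H_hilbert _ _) _.
  apply: (@le_trans _ _ (eps / (`|w| + 1) * `|w|)).
    by rewrite ler_wpM2r// sE.
  by rewrite mulrAC ler_pdivrMr// ler_wpM2l ?ltW// ltrDl.
have sum_real (s : seq T) : \sum_(A <- s) `|'[w, e A]| ^+ 2 \is Num.real.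
  by apply: ger0_real; apply: sumr_ge0 => A _; exact: exprn_ge0.
have l_real : l * `|w| ^+ 2 \is Num.real.
  by apply: ger0_real; rewrite mulr_ge0// exprn_ge0.
split=> [s us|eps /near_l[s us sE]].
  apply/ler_addgt0Pr => eps /near_l[s0 us0 sE].
  have [s2 [us2 ss2 s0s2]] := uniq_union s s0.
  have := sE s2 us2 s0s2; rewrite real_ler_distl ?realB// => /andP[_ le2].
  apply: le_trans le2.
  have perm_s2 : perm_eq s2 (s ++ [seq x <- s2 | x \notin s]).
    apply: uniq_perm => //.
      rewrite cat_uniq us filter_uniq// andbT/=.
      by apply/hasPn => x; rewrite mem_filter => /andP[].
    move=> x; rewrite mem_cat mem_filter.
    by case: (boolP (x \in s)) => //= /ss2 ->.
  rewrite (perm_big _ perm_s2) big_cat /= lerDl.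
  by apply: sumr_ge0 => A _; exact: exprn_ge0.
exists s => //; have := sE s us (fun x xs => xs).
by rewrite real_ler_distl ?realB// => /andP[].
Qed.

End Frames.

Lemma esum_uniq_seq (R : realType) (T : choiceType) (f : T -> R) (l : R) :
  (forall A, 0 <= f A) ->
  (forall s, uniq s -> \sum_(A <- s) f A <= l) ->
  (forall eps, 0 < eps -> exists2 s, uniq s & l - eps <= \sum_(A <- s) f A) ->
  (\esum_(A in [set: T]) (f A)%:E = l%:E)%E.
Proof.
move=> f0 fle fge; apply/eqP; rewrite eq_le; apply/andP; split.
  apply: ub_ereal_sup => _ [B [finB _] <-].
  by rewrite fsbig_finite// sumEFin lee_fin; apply: fle.
apply/lee_addgt0Pr => eps eps0; have [s us sE] := fge _ eps0.
apply: (@le_trans _ _ ((\sum_(A <- s) f A)%:E + eps%:E)%E).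
  by rewrite -EFinD lee_fin -lerBlDr.
apply: leeD2r; apply: ereal_sup_ubound; exists [set` s]; first by split.
by rewrite -fsbig_seq// sumEFin.
Qed.

(** * Embedding into a quasiregular representation *)

Section QuasiregularEmbedding.
Variables (R : realType) (H : completeNormedModType R[i]).
Variable dot : {dot H for Num.conj}.
Hypothesis H_hilbert : is_hilbert dot.
Variables (G : groupType) (rho : G -> H -> H).
Hypothesis rho_unitary : forall g, unitary_operator dot (rho g).
Hypothesis rhoM : forall g h v, rho (g * h)%g v = rho g (rho h v).
Hypothesis rho_irr : forall W : set H, linear_subspace W -> closed W ->
  (forall g v, W v -> W (rho g v)) -> W = [set 0] \/ W = setT.
Variables (K : set G).
Hypotheses (K1 : K 1%g) (KM : forall g h, K g -> K h -> K (g * h)%g).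
Hypothesis KV : forall g, K g -> K g^-1%g.
Variable v : H.
Hypotheses (fv : fixed_vectors rho K v) (v0 : v != 0).
Local Notation C := R[i].
Local Notation "''[' u , v ]" := (dot u%R v%R) : ring_scope.
Local Notation cosets := (right_cosets K).
Local Notation act := (@coset_translate G K).

Lemma coset_repr_exists (A : cosets) :
  exists g, forall x, set_val A x <-> K (x * g^-1)%g.
Proof.
have [g AE] : right_cosets K (set_val A) by exact: set_valP.
exists g => x; rewrite AE; split=> [[k Kk <-]|Kx]; first by rewrite mulgK.
by exists (x * g^-1)%g => //; rewrite mulgVK.
Qed.

Definition coset_repr (A : cosets) : G := sval (cid (coset_repr_exists A)).

Lemma coset_reprP A x : set_val A x <-> K (x * (coset_repr A)^-1)%g.
Proof. exact: (svalP (cid (coset_repr_exists A))). Qed.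

Lemma coset_repr_mem A : set_val A (coset_repr A).
Proof. by apply/(coset_reprP A _).2; rewrite mulgV. Qed.

Lemma cosetP (A B : cosets) x : set_val A x -> set_val B x -> A = B.
Proof.
move=> Ax Bx; apply/val_inj/seteqP.
suff sub (A' B' : cosets) : set_val A' x -> set_val B' x ->
    [set y | set_val A' y] `<=` set_val B' by split; exact: sub.
move=> /(coset_reprP A' x).1 A'x /(coset_reprP B' x).1 B'x y.
move=> /(coset_reprP A' y).1 A'y; apply/(coset_reprP B' y).2.
have -> : (y * (coset_repr B')^-1 = y * (coset_repr A')^-1 *
    (x * (coset_repr A')^-1)^-1 * (x * (coset_repr B')^-1))%g.
  by rewrite invgM invgK !mulgA mulgVK mulgVK.
by apply: (KM _ B'x); apply: (KM A'y); exact: KV.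
Qed.

Lemma coset_translate_mem (A : cosets) g x :
  set_val A x -> set_val (act A g) (x * g)%g.
Proof. by move=> Ax; exists x. Qed.

Lemma coset_translateK g : cancel (act^~ g) (act^~ g^-1%g).
Proof.
move=> A; apply: (@cosetP _ _ (coset_repr A)); last exact: coset_repr_mem.
rewrite -[X in set_val _ X](mulgK g).
by do 2 apply: coset_translate_mem; exact: coset_repr_mem.
Qed.

Lemma coset_translateVK g : cancel (act^~ g^-1%g) (act^~ g).
Proof. by move=> A; have := coset_translateK g^-1%g A; rewrite invgK. Qed.

(** The inverse makes the vector independent of the representative of the right coset, since [v] is
    fixed by [K]. *)
Definition coset_vector (A : cosets) : H := rho (coset_repr A)^-1%g v.
Local Notation e := coset_vector.

Lemma coset_vectorE (A : cosets) x : set_val A x -> e A = rho x^-1%g v.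
Proof.
move=> /(coset_reprP A x).1 Kx; rewrite -[in RHS](fv Kx) -rhoM.
by rewrite mulgA mulVg mul1g.
Qed.

Lemma coset_vector_act (A : cosets) g : rho g^-1%g (e A) = e (act A g).
Proof.
rewrite (coset_vectorE (coset_translate_mem g (coset_repr_mem A))).
by rewrite invgM rhoM.
Qed.

Lemma coset_vector_rho (A : cosets) g : e A = rho g (e (act A g)).
Proof. by rewrite -coset_vector_act (rhoVK rho_unitary rhoM). Qed.

(** Only these cosets contribute to the frame operator on the vectors fixed by [K]. *)
Definition meeting_cosets : set cosets :=
  [set A | exists2 u, fixed_vectors rho K u & '[u, e A] != 0].

Hypothesis meeting_finite : finite_set meeting_cosets.
Hypothesis meeting_fixed : forall A, meeting_cosets A -> fixed_vectors rho K (e A).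

Lemma coset_vector_norm A : `|e A| = `|v|.
Proof. exact: (rho_norm H_hilbert rho_unitary). Qed.

(* The frame operator has finite rank on the vectors fixed by [K], hence an
   eigenvector; the eigenspace is a closed invariant subspace, hence
   everything. *)
Lemma coset_vector_tight_frame :
  exists2 l : C, 0 < l & frame_eigenspace dot e l = setT.
Proof.
have [s0 JE] := (finite_seqP _).1 meeting_finite.
pose J := undup s0.
have JP A : (A \in J) <-> meeting_cosets A by rewrite JE /= mem_undup.
have J_uniq : uniq J by exact: undup_uniq.
pose m := size J; pose b i := e (tnth (in_tuple J) i).
(* The coset [K] itself, with vector [v], keeps the Gram matrix from vanishing. *)
have [A1 A1E] : exists A1 : cosets, set_val A1 1%g.
  have cK : right_cosets K [set (k * 1)%g | k in K] by exists 1%g.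
  by exists (SigSub (mem_set cK)); exists 1%g => //; rewrite mulg1.
have eA1 : e A1 = v by rewrite (coset_vectorE A1E) invg1 (rho1 rho_unitary rhoM).
have vv : '[v, v] != 0 by rewrite (dotxx H_hilbert) expf_eq0 /= normr_eq0.
have A1J : A1 \in J by apply/JP; exists v => //; rewrite eA1.
have [|c [l l0 [u0 uE]]] := @eigenvector_exists R H dot H_hilbert m b.
  have /seq_tnthP[i iE] := A1J.
  by exists i; rewrite /b -[tnth _ _]iE eA1.
set u := \sum_i _ in u0 uE.
have Vu : fixed_vectors rho K u.
  have [V0 VD] := fixed_vectors_sub rho_unitary K.
  rewrite /u; elim/big_rec: _ => // i x _ Vx; apply: VD => //.
  by apply: meeting_fixed; apply/JP; exact: mem_tnth.
have JuE : partial_frame dot e J u = l *: u.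
  by rewrite /partial_frame big_tnth -uE.
(* [u] is fixed by [K], hence orthogonal to the vectors of cosets outside [J]: partial sums are
   constant once they include [J]. *)
have uW : frame_eigenspace dot e l u.
  move=> eps eps0; exists J => // s us Js.
  have perm_s : perm_eq s (J ++ [seq x <- s | x \notin J]).
    apply: uniq_perm => //.
      rewrite cat_uniq J_uniq filter_uniq// andbT/=.
      by apply/hasPn => x; rewrite mem_filter => /andP[].
    move=> x; rewrite mem_cat mem_filter.
    by case: (boolP (x \in J)) => //= /Js ->.
  rewrite /partial_frame (perm_big _ perm_s) big_cat /= -/(partial_frame _ _ _ _).
  rewrite JuE [l *: u + _]addrC addrK big1_seq ?normr0 ?ltW// => A /=.
  rewrite mem_filter => /andP[nJ _].
  suff -> : '[u, e A] = 0 by rewrite scale0r.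
  apply/eqP; apply: contraNT nJ => uA; apply/JP; by exists u.
pose L := `|v| ^+ 2 : C.
have L0 : 0 <= L by exact: exprn_ge0.
have eL A : `|e A| ^+ 2 <= L by rewrite coset_vector_norm.
(* Translation by the inverse representative of [A] carries [e A] to [v] and so injects the cosets
   not orthogonal to [A] into [J]. *)
have overlap (s : seq cosets) A : uniq s ->
    (count (fun B => '[e A, e B] != 0%R) s <= m)%N.
  move=> us; rewrite -size_filter; set s' := seq.filter _ s.
  pose f B := act B (coset_repr A)^-1%g.
  have inj_f : injective f.
    exact: can_inj (coset_translateVK (coset_repr A)).
  rewrite -(size_map f); apply: uniq_leq_size.
    by rewrite map_inj_uniq// filter_uniq.
  move=> _ /mapP[B + ->]; rewrite mem_filter => /andP[AB _].
  apply/JP; exists v => //; rewrite /f -coset_vector_act invgK.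
  move: AB; rewrite -(rho_dot rho_unitary (coset_repr A)).
  by rewrite {1}/coset_vector (rhoVK rho_unitary rhoM).
exists l => //.
have [] // := rho_irr (frame_eigenspace_linear dot e l)
  (frame_eigenspace_closed H_hilbert eL L0 overlap (l := l)).
  move=> g w wE eps eps0; have [s us sE] := wE eps eps0.
  exists [seq act A g^-1%g | A <- s].
    by rewrite map_inj_uniq//; exact: can_inj (coset_translateVK g).
  move=> t ut st; pose t' := [seq act A g | A <- t].
  have -> : partial_frame dot e t (rho g w) = rho g (partial_frame dot e t' w).
    rewrite /partial_frame big_map.
    rewrite (big_morph (rho g) (rhoD rho_unitary g) (rho0 rho_unitary g)).
    apply: eq_bigr => A _; rewrite (rhoZ rho_unitary) -coset_vector_rho.
    by rewrite {1}(coset_vector_rho A g) (rho_dot rho_unitary).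
  rewrite -(rhoZ rho_unitary) -(rhoB rho_unitary) (rho_norm H_hilbert rho_unitary).
  apply: sE; first by rewrite map_inj_uniq//; exact: can_inj (coset_translateK g).
  move=> A As; rewrite -(coset_translateVK g A); apply: map_f; apply: st.
  exact: map_f.
by move=> W0; move: uW; rewrite W0 => /eqP; rewrite (negPf u0).
Qed.

Lemma ell2_coord (f : cosets -> R[i]^o) A :
  ((complex.Re (`|f A| ^+ 2))%:E <= ell2_sqnorm f)%E.
Proof.
apply: ereal_sup_ubound; exists [set A]; first by split=> //; exact: finite_set1.
by rewrite fsbig_set1.
Qed.

Lemma Re_sqr_ge0 (x : R[i]^o) : 0 <= complex.Re (`|x| ^+ 2).
Proof. by rewrite -ler0c RRe_real ?exprn_ge0// ger0_real ?exprn_ge0. Qed.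

Lemma Re_sqrE (x : R[i]^o) : (complex.Re (`|x| ^+ 2))%:C = `|x| ^+ 2.
Proof. by rewrite RRe_real// ger0_real ?exprn_ge0. Qed.

Lemma Re_sqr_normE (w : H) : (complex.Re (`|w| ^+ 2))%:C = `|w| ^+ 2.
Proof. by rewrite RRe_real// ger0_real ?exprn_ge0. Qed.

Lemma ell2_sqnorm_tri (f g h : cosets -> R[i]^o) :
  (ell2_sqnorm (f - h)%R <= (ell2_sqnorm (g - f)%R + ell2_sqnorm (g - f)%R) +
    (ell2_sqnorm (g - h)%R + ell2_sqnorm (g - h)%R))%E.
Proof.
have sq0 (f' : cosets -> R[i]^o) A :
    [set: cosets] A -> (0 <= (complex.Re (`|f' A| ^+ 2))%:E)%E.
  by move=> _; rewrite lee_fin; exact: Re_sqr_ge0.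
rewrite /ell2_sqnorm -!esumD; do ?[by move=> A _; rewrite ?adde_ge0 ?sq0].
apply: le_esum => A _; rewrite -!EFinD lee_fin.
move: (Re_sqrE ((f - h) A)) (Re_sqrE ((g - f) A)) (Re_sqrE ((g - h) A)).
move: (complex.Re _) (complex.Re _) (complex.Re _) => x1 x2 x3 E1 E2 E3.
rewrite -lecR !rmorphD /= E1 E2 E3 !fctE; set x := f A; set y := g A; set z := h A.
have -> : x - z = (y - z) - (y - x) by rewrite opprB [RHS]addrC subrKA.
set p := y - z; set q := y - x.
have le1 : `|p - q| ^+ 2 <= (`|p| + `|q|) ^+ 2.
  by rewrite ler_sqr ?nnegrE ?addr_ge0// ler_normB.
apply: le_trans le1 _; rewrite -subr_ge0.
have -> : `|q| ^+ 2 + `|q| ^+ 2 + (`|p| ^+ 2 + `|p| ^+ 2) - (`|p| + `|q|) ^+ 2 =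
  (`|p| - `|q|) ^+ 2 by ring.
by rewrite -realEsqr realB ?normr_real.
Qed.

(** Dividing the frame coefficients by the square root of [l] makes them an isometry. Its image is
    closed because preimages of approximants form a Cauchy sequence in the complete space [H]. *)
Theorem quasiregular_embedding :
  exists W : set (cosets -> R[i]^o),
    quasiregular_subrepresentation W /\ equivalent_to_subrepresentation rho W.
Proof.
have [l l0 lT] := coset_vector_tight_frame.
pose r := sqrtC l; have r0 : 0 < r by rewrite sqrtC_gt0.
pose T w : cosets -> R[i]^o := fun A => '[w, e A] / r.
have Tlin : linear T.
  move=> c x y; apply/funext => A.
  by rewrite /T linearDl /= (dotZl dot) mulrDl -mulrA.
have Tsq w : ell2_sqnorm (T w) = (complex.Re (`|w| ^+ 2))%:E.
  have wE : frame_eigenspace dot e l w by rewrite lT.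
  have [le_l ge_l] := frame_eigenspace_sqnorm H_hilbert (ltW l0) wE.
  have TE A : `|T w A| ^+ 2 = `|'[w, e A]| ^+ 2 / l.
    by rewrite normrM exprMn normfV (ger0_norm (ltW r0)) exprVn sqrtCK.
  have sumE (s : seq cosets) :
      (\sum_(A <- s) complex.Re (`|T w A| ^+ 2))%:C =
      (\sum_(A <- s) `|'[w, e A]| ^+ 2) / l.
    by rewrite rmorph_sum mulr_suml; apply: eq_bigr => A _; rewrite -TE; exact: Re_sqrE.
  apply: esum_uniq_seq => [A|s us|eps eps0]; first exact: Re_sqr_ge0.
    by rewrite -lecR sumE Re_sqr_normE ler_pdivrMr// mulrC le_l.
  have [|s us sE] := ge_l (eps%:C * l); first by rewrite mulr_gt0// ltcR.
  exists s => //; rewrite -lecR sumE rmorphB /= Re_sqr_normE ler_pdivlMr//.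
  by rewrite mulrBl [_ * l]mulrC.
have Trho g w : T (rho g w) = quasiregular g (T w).
  apply/funext => A; rewrite /T /quasiregular -coset_vector_act.
  by rewrite (rho_dotV rho_unitary rhoM).
have TB x y : T (x - y) = T x - T y.
  by rewrite -[x - y]addrC -scaleN1r Tlin scaleN1r addrC.
exists (T @` [set: H]); split; last first.
  by exists T.
split.
- by move=> _ [w _ <-]; rewrite /ell2 /= Tsq ltry.
- split; first by exists 0 => //; rewrite -(subrr 0) TB subrr.
  by move=> c _ _ [x _ <-] [y _ <-]; exists (c *: x + y) => //; exact: Tlin.
- move=> f fell2 fapprox.
  have /choice[w wE] : forall n : nat, exists w,
      (ell2_sqnorm (f - T w)%R < (n.+1%:R^-1)%:E)%E.
    move=> n; have [|_ [w _ <-] lt] := fapprox n.+1%:R^-1.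
      by rewrite invr_gt0.
    by exists w.
  have small (eps : C) : 0 < eps -> exists N : nat, forall n, (N <= n)%N ->
      (n.+1%:R^-1)%:C * 4 < eps ^+ 2.
    move=> eps0; have eE : eps = (complex.Re eps)%:C by rewrite RRe_real// gtr0_real.
    have re0 : 0 < complex.Re eps by rewrite -ltcR -eE.
    have a0 : 0 < complex.Re eps ^+ 2 / 4 by rewrite divr_gt0// exprn_gt0.
    exists (Num.truncn (complex.Re eps ^+ 2 / 4)^-1) => n Nn.
    rewrite eE -rmorphXn -ltr_pdivlMr// -[4]/(4%:R) -(rmorph_nat (real_complex R)).
    rewrite -fmorphV -rmorphM ltcR /= invf_plt ?posrE//.
    by rewrite (lt_le_trans (truncnS_gt _))// ler_nat ltnS.
  have dist m n : `|w m - w n| ^+ 2 <= ((m.+1%:R^-1)%:C + (n.+1%:R^-1)%:C) *+ 2.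
    have := ell2_sqnorm_tri (T (w m)) f (T (w n)).
    rewrite -TB Tsq => /le_lt_trans h.
    have {h}/ltW := h _ (lteD (lteD (wE m) (wE m)) (lteD (wE n) (wE n))).
    rewrite -!EFinD lee_fin -lecR Re_sqr_normE !rmorphD /= => h.
    by apply: le_trans h _; rewrite le_eqVlt; apply/orP; left; apply/eqP; ring.
  have [|z zE] := @complete_cauchy R H w.
    move=> eps eps0; have [N NE] := small eps eps0; exists N => m n Nm Nn.
    rewrite -ltr_sqr ?nnegrE ?(ltW eps0)//; apply: le_lt_trans (dist m n) _.
    have := ltrD (NE m Nm) (NE n Nn).
    have -> : (m.+1%:R^-1)%:C * 4 + (n.+1%:R^-1)%:C * 4 =
      (((m.+1%:R^-1)%:C + (n.+1%:R^-1)%:C) *+ 2) *+ 2 :> C by ring.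
    by rewrite -mulr2n ltrMn2r.
  (* Each coordinate is bounded by the norm, so [f] and [T z] can be compared coordinatewise. *)
  exists z => //; apply/esym/funext => A; apply/eqP; rewrite -subr_eq0 -normr_eq0.
  apply/eqP; apply: (@ge0_eq0_eps R 2) => // eps eps0 _.
  have [N1 N1E] := small eps eps0; have [N2 N2E] := zE eps eps0.
  pose n := maxn N1 N2.
  have -> : f A - T z A = (f A - T (w n) A) - (T z A - T (w n) A).
    by rewrite opprB addrA subrK.
  have coord_le (h : cosets -> R[i]^o) (y : C) : 0 <= y ->
      (ell2_sqnorm h <= (complex.Re (`|y| ^+ 2))%:E)%E -> `|h A| <= y.
    move=> y0 hy; have := le_trans (ell2_coord h A) hy.
    rewrite lee_fin -lecR !Re_sqrE ler_sqr ?nnegrE//.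
    by rewrite (ger0_norm y0).
  apply: le_trans (ler_normB _ _) _.
  have -> : eps * 2 = eps + eps by ring.
  apply: lerD.
    apply: (coord_le (f - T (w n))); first exact: ltW.
    apply: ltW; apply: lt_trans (wE n) _; rewrite lte_fin -ltcR Re_sqrE.
    rewrite (ger0_norm (ltW eps0)); apply: le_lt_trans (N1E n (leq_maxl _ _)).
    by rewrite ler_peMr// ?ler1n// -(rmorph0 (real_complex R)) lecR invr_ge0.
  apply: (coord_le (T z - T (w n))); first exact: ltW.
  rewrite -TB Tsq lee_fin -lecR Re_sqr_normE Re_sqrE (ger0_norm (ltW eps0)).
  rewrite ler_sqr ?nnegrE ?(ltW eps0)//; apply: ltW; apply: N2E.
  exact: leq_maxr.
- by move=> g _ [w _ <-]; exists (rho g w).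
Qed.

End QuasiregularEmbedding.

(** * Setwise stabilizers and transporters of balls *)

Section SetwiseStabilizer.
Variables (R : realType) (Lambda : set R) (U : metricType R).
Hypothesis U_urysohn : is_urysohn Lambda U.
Local Notation d := (@mdist R U).

Lemma ball_stabilizerE n (a : 'I_n -> U) (S : 'I_n -> set R)
    (B : 'I_n -> set U) :
  (forall j, lower_set (S j)) -> (forall j, B j = [set x | S j (d (a j) x)]) ->
  ball_stabilizer B = family_stabilizer a S.
Proof.
move=> lS BE; apply/seteqP; split=> g gS j.
  have : B j (g (a j)).
    rewrite -(gS j); exists (a j) => //.
    by rewrite BE /= mdistxx; have [] := lS j.
  by rewrite BE.
rewrite BE; apply/seteqP; split=> [_ [x Sx <-]|y Sy] /=.
  by apply: (lower_set_tri U_urysohn (lS j) (gS j)); rewrite isometry_dist.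
exists (g^-1%g y); last exact: isometry_KV.
rewrite /= metric_sym isometry_distV.
apply: (lower_set_tri U_urysohn (lS j) _ (gS j)).
by rewrite metric_sym.
Qed.

Lemma separated_trivIset n (a : 'I_n -> U) (S : 'I_n -> set R) :
  (forall j, lower_set (S j)) -> separated_family a S ->
  trivIset [set: 'I_n] (fun j => [set x | S j (d (a j) x)]).
Proof.
move=> lS sep i j _ _ [x /= [Si Sj]]; apply: contrapT => /eqP ij.
have [sub|sub] := lower_set_total (lS i) (lS j).
- apply: (sep j i); first by rewrite eq_sym.
  apply: (lower_set_tri U_urysohn (lS j) Sj).
  by rewrite metric_sym; exact: sub.
- apply: (sep i j) => //; apply: (lower_set_tri U_urysohn (lS i) Si).
  by rewrite metric_sym; exact: sub.
Qed.

(** Isometries that permute the balls in the same way differ by an element of the stabilizer: [g]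
    and [h] both carry ball [s i] to ball [i]. *)
Lemma transporter_distance n (a : 'I_n -> U) (S : 'I_n -> set R)
    (s : 'I_n -> 'I_n) (g h : isometries U) :
  (forall j, lower_set (S j)) -> injective s ->
  (forall j, S j (d (a j) (g (a (s j))))) ->
  (forall j, S j (d (a j) (h (a (s j))))) ->
  (forall j, radius_le Lambda (S j) (S (s j))) ->
  forall j, S j (d (g (a j)) (h (a j))).
Proof.
move=> lS inj_s gS hS sS j; have [s' _ sK] := injF_bij inj_s.
rewrite -(sK j); set i := s' j.
have [->|Ld] := mdist_spectrum U_urysohn (g (a (s i))) (h (a (s i))).
  by have [] := lS (s i).
apply: sS; split=> //; apply: (lower_set_tri U_urysohn (lS i) _ (hS i)).
by rewrite metric_sym.
Qed.

End SetwiseStabilizer.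

Theorem theorem1 (R : realType) (Lambda : set R) (U : metricType R)
    (H : completeNormedModType R[i]) (dot : {dot H for Num.conj})
    (rho : isometries U -> H -> H)
    (Lambda_countable : countable Lambda)
    (Lambda_gt0 : forall r, Lambda r -> 0 < r)
    (U_urysohn : is_urysohn Lambda U)
    (H_hilbert : is_hilbert dot)
    (H_separable : separable_space H)
    (rho_unitary : unitary_representation dot rho)
    (rho_irreducible : irreducible_representation rho) :
  exists (n : nat) (a : 'I_n -> U) (t : 'I_n -> ball_kind * \bar R),
    [/\ forall j, perfect_type Lambda (t j),
        trivIset [set: 'I_n] (fun j => ball_of (a j) (t j)) &
        exists W : set (right_cosets
                          (ball_stabilizer (fun j => ball_of (a j) (t j))) ->
                        R[i]^o),
          quasiregular_subrepresentation W /\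
          equivalent_to_subrepresentation rho W].
Proof.
have [unit rhoM _] := rho_unitary.
have [[v1 v10] rho_irr] := rho_irreducible.
pose P n := `[< exists (a : 'I_n -> U) (S : 'I_n -> set R),
  supporting_family Lambda rho a S >].
have exP : exists n, P n.
  have [n [a [S ?]]] := supporting_family_exists U_urysohn H_hilbert rho_unitary v10.
  by exists n; apply/asboolP; exists a, S.
have [n /asboolP[a [S0 supS0]] n_min] := ex_minnP exP.
have {}n_min m (b : 'I_m -> U) (S : 'I_m -> set R) :
    supporting_family Lambda rho b S -> (n <= m)%N.
  by move=> ?; apply: n_min; apply/asboolP; exists b, S.
have [S supS satS] := saturated_supporting_family Lambda_countable U_urysohn
  H_hilbert unit rhoM rho_irreducible n_min supS0.
have meetS := saturated_meet U_urysohn H_hilbert unit rhoM n_min supS satS.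
have sepS := supporting_family_separated U_urysohn n_min supS.
have [aS [v fv v0]] := supS; have lS j := (aS j).1.
have /choice[t tP] : forall j, exists t, perfect_type Lambda t /\
    forall x : U, ball_of x t = [set y | S j (mdist x y)].
  by move=> j; have [t ? ?] := admissible_perfect_type Lambda_gt0 U_urysohn (aS j);
    exists t.
have BE : (fun j => ball_of (a j) (t j)) = (fun j => [set y | S j (mdist (a j) y)]).
  by apply/funext => j; exact: (tP j).2.
exists n, a, t; split; first by move=> j; exact: (tP j).1.
  by rewrite BE; exact: (separated_trivIset U_urysohn).
rewrite (ball_stabilizerE U_urysohn lS (fun j => congr1 (@^~ j) BE)).
set K := family_stabilizer a S.
have K1 : K 1%g by exact: family_stabilizer1.
have KM : forall g h, K g -> K h -> K (g * h)%g.
  exact: (family_stabilizerM U_urysohn lS).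
have KV : forall g, K g -> K g^-1%g by exact: family_stabilizerV.
pose e := coset_vector rho (K := K) v.
(* The permutation is stored as a finite function, so that its values range over a finite type. *)
have transport A : meeting_cosets dot rho (K := K) v A ->
    exists s : {ffun 'I_n -> 'I_n}, injective s /\ forall j,
      [/\ S j (mdist (a j) ((coset_repr A)^-1%g (a (s j)))) &
          radius_le Lambda (S j) (S (s j))].
  move=> [u fu uA]; have [s inj_s sE] := meetS _ _ _ fu fv uA.
  exists (finfun s); split=> [x y|j]; first by rewrite !ffunE => /inj_s.
  by rewrite ffunE; have [] := sE j.
apply: (quasiregular_embedding H_hilbert unit rhoM rho_irr K1 KM KV fv v0).
- have /choice[f fE] : forall A, exists s : {ffun 'I_n -> 'I_n},
      meeting_cosets dot rho (K := K) v A -> injective s /\ forall j,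
      [/\ S j (mdist (a j) ((coset_repr A)^-1%g (a (s j)))) &
          radius_le Lambda (S j) (S (s j))].
    move=> A; have [/transport[s sE]|] := pselect (meeting_cosets dot rho (K := K) v A).
      by exists s.
    by exists [ffun j => j].
  (* Meeting cosets inducing the same permutation coincide, so there are finitely many. *)
  have inj_f : {in meeting_cosets dot rho (K := K) v &, injective f}.
    move=> A B /set_mem /fE[inj_s sA] /set_mem /fE[_ sB] fAB.
    apply: (cosetP KM KV (x := coset_repr A)); first exact: coset_repr_mem.
    apply/(coset_reprP B _).2; rewrite -[coset_repr A]invgK.
    apply/family_stabilizerVM.
    apply: (transporter_distance U_urysohn lS inj_s).
    - by move=> j; have [] := sA j.
    - by move=> j; rewrite fAB; have [] := sB j.
    - by move=> j; have [] := sA j.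
  rewrite -(eq_finite_set (inj_card_eq inj_f)); exact: finite_finset.
(* [k * g] permutes the balls as [g] does, so [g^-1 * k * g] lies in [K] and [rho k] fixes
   [rho g v]. *)
- move=> A /transport[s [inj_s sA]] k Kk.
  rewrite /coset_vector; set g := (coset_repr A)^-1%g.
  suff Kg : K (g^-1 * (k * g))%g by rewrite -[in RHS](fv _ Kg) -!rhoM mulgA mulgV mul1g.
  apply/family_stabilizerVM; apply: (transporter_distance U_urysohn lS inj_s).
  - by move=> j; have [] := sA j.
  - move=> j; rewrite isometry_mulE.
    apply: (lower_set_tri U_urysohn (lS j) (Kk j)).
    by rewrite isometry_dist; have [] := sA j.
  - by move=> j; have [] := sA j.
Qed.
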